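(* Assume the eigenvalues $\lambda_1,\dots,\lambda_N$ of $R_r$ are pairwise distinct, and let all parameters except $\rho$ be fixed. With $Z=\frac{d_1^\tau d_2^\tau\gamma_{th}}{\eta\theta\sigma_1}$ define $$A(\rho)=\frac1\rho\left[\frac{\gamma_{th}d_1^\tau}{(1-\theta)\lambda_1}-\sum_{i=1}^N\frac{\lambda_i^{N-2}}{\prod_{j\ne i}(\lambda_i-\lambda_j)}\,Z\ln\frac{Z}{\lambda_i\rho}\right].$$ Then the outage probability $P_S(\rho)=P\{\gamma_S<\gamma_{th}\}$ satisfies $\lim_{\rho\to\infty}P_S(\rho)/A(\rho)=1$. In particular, for $N\ge2$, $P_S(\rho)$ decays like $\rho^{-1}$ (diversity order one).
   Context: Fix an integer $N\ge 1$ and constants $\eta\in(0,1]$, $\theta\in(0,1)$, $d_1,d_2>0$, $\tau>0$, $\gamma_{th}>0$; $\rho>0$ is the variable. Let $\lambda_1\ge\dots\ge\lambda_N>0$ be the eigenvalues of the receive correlation matrix $R_r$ (an $N\times N$ Hermitian positive definite matrix) and $\sigma_1>0$ the largest eigenvalue of the transmit correlation matrix $R_t$. Let $g_1,\dots,g_N,q$ be i.i.d. zero-mean circularly symmetric complex Gaussian random variables of unit variance, $S=\sum_{i=1}^N\lambda_i|g_i|^2$, and $$\gamma_S=\frac{\frac{\eta\theta(1-\theta)\rho^2}{d_1^{2\tau}d_2^\tau}\,S\,\lambda_1|g_1|^2\,\sigma_1|q|^2}{\frac{\eta\theta\rho}{d_1^\tau d_2^\tau}\,S\,\sigma_1|q|^2+\frac{(1-\theta)\rho}{d_1^\tau}\lambda_1|g_1|^2+1}.$$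 Empty products equal $1$. *)

(* Defs.v *)
From HB Require Import structures.
From mathcomp Require Import all_boot all_order all_algebra.
From mathcomp Require Import all_classical all_reals all_analysis.
Set Implicit Arguments.
Unset Strict Implicit.
Unset Printing Implicit Defensive.
Import Order.TTheory GRing.Theory Num.Theory.
Import numFieldTopology.Exports numFieldNormedType.Exports.
Local Open Scope classical_set_scope.
Local Open Scope ring_scope.

Definition mutually_independent {R : realType} (d : measure_display)
  (T : measurableType d) (P : probability T R) (I : finType)
  (X : I -> T -> R) : Prop :=
  forall B : I -> set R, (forall i, measurable (B i)) ->
    P (\bigcap_(i in [set: I]) (X i @^-1` B i)) = (\prod_(i : I) P (X i @^-1` B i))%E.

Definition has_normal_law {R : realType} (d : measure_display)
  (T : measurableType d) (P : probability T R) (X : T -> R) (m s : R) : Prop :=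
  forall A : set R, measurable A -> P (X @^-1` A) = normal_prob m s A.

(* A family W of complex random variables given by real and imaginary parts
   W k true (real part) and W k false (imaginary part), k : I, is i.i.d.
   zero-mean circularly symmetric complex Gaussian with unit variance:
   all real components are mutually independent, each N(0, 1/2). *)
Definition iid_CSCG {R : realType} (d : measure_display)
  (T : measurableType d) (P : probability T R) (I : finType)
  (W : I -> bool -> T -> R) : Prop :=
  mutually_independent P (fun kb : I * bool => W kb.1 kb.2) /\
  forall k b, has_normal_law P (W k b) 0 (Num.sqrt (2^-1)).

Definition sqmod {R : realType} (T : Type) (I : Type)
  (W : I -> bool -> T -> R) (k : I) (w : T) : R :=
  W k true w ^+ 2 + W k false w ^+ 2.

(* Main.v *)
Require Import Defs.
From HB Require Import structures.
From mathcomp Require Import all_boot all_order all_algebra.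
From mathcomp Require Import all_classical all_reals all_analysis.
From mathcomp Require Import measurable_realfun ring lra.
Import Order.TTheory GRing.Theory Num.Theory.
Import numFieldTopology.Exports numFieldNormedType.Exports.
Local Open Scope classical_set_scope.
Local Open Scope ring_scope.

(** Write [x] and [y] for the two hop SNRs, so that the end-to-end SNR is
    [x y / (x + y + 1)].  Up to an event where both hops are weak, it falls below
    [gth] exactly when [x < gth] or [y < gth], with an arbitrarily small relative
    loss in the threshold.  The first event concerns [|g_1|^2], whose law near 0 is
    read off the area of a disc.  The second one is [S |q|^2 < e], with probability
    about [e E(1/S)]; writing [1/S] as the integral of [exp (- s S)] reduces it to
    the Laplace transform [prod_i (1 + lam_i s)^-1] of [S], which partial fractions
    integrate to a combination of logarithms.  Cutting this integral at [s ~ 1/e]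
    makes the argument uniform in [N], although [E(1/S)] is infinite for [N = 1],
    where a factor [ln rho] appears. *)

(** The two hops are dependent, since [|g_1|^2] enters both the first hop and [S]. The union of the
    two events is handled by inclusion-exclusion, so the joint event only has to be negligible on
    the scale of the answer. For N >= 2 a second branch [g_2], independent of [g_1], makes it
    O(rho^(-3/2)); for N = 1 the crude O(1/rho) given by the first hop alone is enough, the answer
    being of order ln rho / rho. Both scales are carried by one weight [v], with limit [vinf], and
    by one identity [vinf * sc = 0], where [sc] is the sum of the partial fraction coefficients:
    [sc] vanishes for N >= 2, and [vinf] vanishes for N = 1. The same identity makes the limit
    insensitive to the constant in the cut-off, because replacing s by k s shifts the sum of
    logarithms by about [sc * ln k]. The lower bound exploits this freedom: a cut-off kap / e makes
    the truncation error a fraction kap of the main term, up to a negligible quantity. *)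

(** * Independence of disjoint groups of coordinates *)

Section independence_of_groups.
Context {R : realType} {d : measure_display} {T : measurableType d}.
Variables (P : probability T R) (I : finType) (X : I -> T -> R).
Hypothesis mX : forall i, measurable_fun setT (X i).
Hypothesis indepX : mutually_independent P X.

(** A pi-system for the coordinates in [J]. Imposing [B i = setT] outside [J], instead of
    intersecting over [J] only, lets [mutually_independent] apply verbatim. *)
Definition cylinder (J : pred I) : set_system T :=
  [set E | exists B : I -> set R, [/\ forall i, measurable (B i),
    forall i, ~~ J i -> B i = setT &
    E = \bigcap_(i in [set: I]) (X i @^-1` B i)]].

Lemma cylinderT J : cylinder J setT.
Proof.
exists (fun=> setT); split => //.
by rewrite bigcapT// => i _; rewrite preimage_setT.
Qed.

Lemma setI_closed_cylinder J : setI_closed (cylinder J).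
Proof.
move=> _ _ [B [mB BJ ->]] [C [mC CJ ->]].
exists (fun i => B i `&` C i); split.
- by move=> i; exact: measurableI.
- by move=> i Ji; rewrite BJ// CJ// setIT.
- by rewrite -bigcapI.
Qed.

Lemma cylinder_measurable J : cylinder J `<=` measurable.
Proof.
move=> _ [B [mB _ ->]]; apply: fin_bigcap_measurable; first exact: finite_finset.
by move=> i _; rewrite -[X in measurable X]setTI; exact: mX.
Qed.

Lemma cylinder_preimage (J : pred I) i (A : set R) : J i -> measurable A ->
  cylinder J (X i @^-1` A).
Proof.
move=> Ji mA; exists (fun j => if j == i then A else setT); split.
- by move=> j; case: ifP.
- by move=> j; case: eqVneq => // ->; rewrite Ji.
- apply/seteqP; split => [w Aw j _|w /(_ i Logic.I)]/=; last by rewrite eqxx.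
  by case: eqVneq => //= ->.
Qed.

(** For each coordinate at least one of the two constraints is [setT], so every factor of the
    product formula splits. *)
Lemma indep_cylinder (J1 J2 : pred I) E1 E2 : (forall i, J1 i -> ~~ J2 i) ->
  cylinder J1 E1 -> cylinder J2 E2 -> P (E1 `&` E2) = (P E1 * P E2)%E.
Proof.
move=> J12 [B [mB BJ ->]] [C [mC CJ ->]].
rewrite -bigcapI (indepX B)// (indepX C)//.
under eq_bigcapr do rewrite -preimage_setI.
rewrite (indepX (fun i => B i `&` C i)); last by move=> i; exact: measurableI.
rewrite -big_split/=; apply: eq_bigr => i _.
have [Ji|Ji] := boolP (J1 i).
  by rewrite (CJ _ (J12 _ Ji)) setIT preimage_setT probability_setT mule1.
by rewrite BJ// setTI preimage_setT probability_setT mul1e.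
Qed.

Lemma sigma_cylinder_measurable J : <<s cylinder J >> `<=` measurable.
Proof.
apply: smallest_sub; last exact: cylinder_measurable.
exact: sigma_algebra_measurable.
Qed.

(** With [E1] fixed, P restricted to [E1] and P scaled by [P E1] are finite measures that agree on a
    pi-system, hence on the sigma-algebra it generates. *)
Lemma indep_sigma_cylinder_half (J2 : pred I) E1 E2 :
  measurable E1 ->
  (forall E, cylinder J2 E -> P (E1 `&` E) = (P E1 * P E)%E) ->
  <<s cylinder J2 >> E2 -> P (E1 `&` E2) = (P E1 * P E2)%E.
Proof.
move=> mE1 H E2J.
have PE1 : (fine (P E1))%:E = P E1 by rewrite fineK// fin_num_measure.
have PE1ge0 : 0 <= fine (P E1) by rewrite fine_ge0.
have /= := @g_sigma_algebra_measure_unique _ _ _ (cylinder J2)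
  (@cylinder_measurable J2) (fun=> setT) (fun=> cylinderT J2) _
  (mrestr P mE1) (mscale (NngNum PE1ge0) P) (@setI_closed_cylinder J2)
  _ _ E2 E2J.
move=> Hu; rewrite setIC -PE1; apply: Hu.
- by rewrite bigcup_const//; exists 0%N.
- by move=> A /H; rewrite /mrestr /mscale/= PE1 setIC.
- by move=> _; rewrite /mrestr setTI -PE1 ltry.
Qed.

Lemma indep_sigma_cylinder (J1 J2 : pred I) E1 E2 :
  (forall i, J1 i -> ~~ J2 i) ->
  <<s cylinder J1 >> E1 -> <<s cylinder J2 >> E2 ->
  P (E1 `&` E2) = (P E1 * P E2)%E.
Proof.
move=> J12 E1J E2J.
apply: (@indep_sigma_cylinder_half J2) => //.
  exact: sigma_cylinder_measurable E1J.
move=> E EJ; rewrite setIC muleC; apply: (@indep_sigma_cylinder_half J1) => //.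
  exact: cylinder_measurable EJ.
by move=> E' E'J; rewrite setIC muleC; exact: indep_cylinder E'J EJ.
Qed.

(** Stated as measurability for a smaller sigma-algebra on [T], so that stability under sums and
    products comes from the ordinary measurability lemmas. *)
Definition depends_on (J : pred I) (U : T -> R) :=
  measurable_fun (setT : set (g_sigma_algebraType (cylinder J))) U.

Lemma depends_on_coord (J : pred I) i : J i -> depends_on J (X i).
Proof.
move=> Ji _ A mA; rewrite setTI; apply: sub_sigma_algebra.
exact: cylinder_preimage.
Qed.

End independence_of_groups.
Arguments depends_on {R d T I} X J U.

(** * Independent pairs and iterated integrals *)

Section pair_independence.
Context {R : realType} {d : measure_display} {T : measurableType d}.
Variables (P : probability T R).

Definition indep2 (U V : T -> R) := forall A B, measurable A -> measurable B ->
  P (U @^-1` A `&` V @^-1` B) = (P (U @^-1` A) * P (V @^-1` B))%E.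

Lemma depends_on_indep2 (I : finType) (X : I -> T -> R) (J1 J2 : pred I) U V :
  (forall i, measurable_fun setT (X i)) -> mutually_independent P X ->
  (forall i, J1 i -> ~~ J2 i) ->
  depends_on X J1 U -> depends_on X J2 V -> indep2 U V.
Proof.
move=> mX iX J12 UJ VJ A B mA mB.
apply: (@indep_sigma_cylinder _ _ _ _ _ _ mX iX J1 J2) => //.
- by have := UJ measurableT A mA; rewrite setTI.
- by have := VJ measurableT B mB; rewrite setTI.
Qed.

Local Open Scope ereal_scope.

(** Independence says that the joint law agrees with the product of the two laws on rectangles;
    uniqueness of the product measure and Tonelli do the rest. *)
Lemma indep2_integral (U V : {mfun T >-> R}) (h : R * R -> \bar R) :
  indep2 U V -> measurable_fun [set: R * R] h -> (forall z, 0 <= h z) ->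
  \int[P]_w h (U w, V w) =
  \int[distribution P U]_x \int[distribution P V]_y h (x, y).
Proof.
move=> UV mh h0.
have mUV : measurable_fun setT (fun w => (U w, V w)).
  exact: measurable_fun_pair.
rewrite -(fubini_tonelli1 h)//.
transitivity (\int[pushforward P (fun w => (U w, V w))]_z h z).
  by rewrite ge0_integral_pushforward.
apply: eq_measure_integral => //= A mA _.
apply/esym/(@product_measure_unique _ _ _ _ _ (distribution P U)
  (distribution P V) (pushforward P (fun w => (U w, V w)))) => //.
Qed.

End pair_independence.

(** * Gaussian integrals *)

Section normal_density.
Context {R : realType}.
Local Notation mu := (@lebesgue_measure R).
Local Open Scope ereal_scope.

(** The Radon-Nikodym derivative and [normal_pdf] have the same integral over every measurable set,
    hence coincide almost everywhere. *)
Lemma integral_normal_prob (m s : R) (f : R -> \bar R) :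
  (normal_prob m s).-integrable setT f ->
  \int[normal_prob m s]_x f x = \int[mu]_x (f x * (normal_pdf m s x)%:E).
Proof.
move=> fi; have mf := measurable_int _ fi.
have dom : (normal_prob m s : set R -> \bar R) `<< mu.
  exact: normal_prob_dominates.
rewrite -(Radon_Nikodym_change_of_variables dom measurableT fi).
apply: ae_eq_integral => //.
- by apply: emeasurable_funM => //.
- apply: emeasurable_funM => //.
  by apply/measurable_EFinP; exact: measurable_normal_pdf.
apply: ae_eqe_mul2l; apply: integral_ae_eq => //.
- exact: Radon_Nikodym_integrable.
- by apply/measurable_EFinP; exact: measurable_normal_pdf.
- by move=> E _ mE; rewrite -Radon_Nikodym_integral.
Qed.

Local Notation s0 := (Num.sqrt (2^-1 : R)).

Lemma normal_pdf_half (x : R) :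
  normal_pdf 0 s0 x = ((Num.sqrt pi)^-1 * expR (- x ^+ 2))%R.
Proof.
have s0_sqr : (s0 ^+ 2 = 2^-1)%R by rewrite sqr_sqrtr.
have s0_neq0 : (s0 != 0)%R by rewrite gt_eqF// sqrtr_gt0.
rewrite normal_pdfE// /normal_peak /normal_fun s0_sqr subr0; congr (_ * _)%R.
  by congr ((Num.sqrt _)^-1)%R; field.
by congr expR; field.
Qed.

Lemma integral_gauss_scale (a : R) : (0 < a)%R ->
  \int[mu]_x (expR (- (a * x ^+ 2)))%:E = (Num.sqrt (pi / a))%:E.
Proof.
(* The standard deviation for which the normal density is proportional to the integrand; its total
   mass 1 then yields the value. *)
move=> a0; set s := (Num.sqrt ((2 * a)^-1))%R.
have s_sqr : (s ^+ 2 = (2 * a)^-1)%R.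
  by rewrite sqr_sqrtr// invr_ge0 mulr_ge0// ltW.
have s_neq0 : (s != 0)%R by rewrite gt_eqF// sqrtr_gt0 invr_gt0 mulr_gt0.
have pa : (0 < Num.sqrt (pi / a))%R by rewrite sqrtr_gt0 divr_gt0// pi_gt0.
rewrite -[RHS]mule1 -(integral_normal_pdf 0 s) -ge0_integralZl//=; first last.
- by move=> x _; rewrite lee_fin normal_pdf_ge0.
- by apply/measurable_EFinP; exact: measurable_normal_pdf.
apply: eq_integral => x _; rewrite -EFinM; congr EFin.
rewrite normal_pdfE// /normal_peak /normal_fun s_sqr subr0.
have -> : ((2 * a)^-1 * pi *+ 2 = pi / a)%R by field; rewrite gt_eqF.
by rewrite mulVKf ?gt_eqF//; congr expR; field; rewrite gt_eqF.
Qed.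

Lemma normal_half_laplace (s : R) : (0 <= s)%R ->
  \int[normal_prob 0 s0]_x (expR (- (s * x ^+ 2)))%:E =
  ((Num.sqrt (1 + s))^-1)%:E.
Proof.
move=> s_ge0.
have mexp : measurable_fun setT (fun x : R => expR (- (s * x ^+ 2))).
  apply: measurableT_comp => //; apply: measurableT_comp => //.
  by apply: measurable_funM => //; exact: measurable_funX.
rewrite integral_normal_prob; last first.
  apply: (@le_integrable _ _ _ _ _ measurableT _ (cst 1)).
  - exact/measurable_EFinP.
  - move=> x _; rewrite /= lee_fin normr1 ger0_norm ?expR_ge0//.
    by rewrite -expR0 ler_expR oppr_le0 mulr_ge0// sqr_ge0.
  - exact: finite_measure_integrable_cst.
under eq_integral => x _.
  rewrite normal_pdf_half -EFinM mulrCA -expRD.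
  have -> : (- (s * x ^+ 2) - x ^+ 2 = - ((1 + s) * x ^+ 2))%R by ring.
  rewrite EFinM; over.
have s1 : (0 < 1 + s)%R by rewrite ltr_wpDr.
rewrite ge0_integralZl//=; first last.
  apply/measurable_EFinP; apply: measurableT_comp => //; apply: measurableT_comp => //.
  by apply: measurable_funM => //; exact: measurable_funX.
rewrite integral_gauss_scale// -EFinM sqrtrM ?pi_ge0// mulKf ?sqrtrV//.
  exact: ltW.
by rewrite gt_eqF// sqrtr_gt0 pi_gt0.
Qed.

End normal_density.

(** * Area of a disc *)

Section disc_area.
Context {R : realType}.
Local Notation mu := (@lebesgue_measure R).

Lemma derivable_oo_LRcontinuousT (F : R -> R) (a b : R) :
  (forall x, derivable F x 1) -> derivable_oo_LRcontinuous F a b.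
Proof.
move=> dF.
have cF : continuous F.
  by move=> x; apply: differentiable_continuous; apply/derivable1_diffP.
split=> //.
- by apply: cvg_at_right_filter; exact: cF.
- by apply: cvg_at_left_filter; exact: cF.
Qed.

Lemma integral_cos_sqr :
  (\int[mu]_(x in `[(- (pi / 2))%R, (pi / 2)%R]) (2 * cos x ^+ 2)%:E = pi%:E)%E.
Proof.
have D (x : R) : is_derive x 1 (fun y : R => y + sin y * cos y) (2 * cos x ^+ 2).
  apply: is_derive_eq.
  rewrite /GRing.scale/= /GRing.scale/=; have := cos2Dsin2 x; lra.
rewrite (@continuous_FTC2 _ _ (fun x => x + sin x * cos x)).
- rewrite cosN cos_pihalf !mulr0 !addr0 -EFinB; congr EFin; lra.
- by rewrite ltrNl; have := pi_gt0 R; lra.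
- apply: continuous_subspaceT => x; apply: cvgM; first exact: cvg_cst.
  by apply: cvgM; exact: continuous_cos.
- by apply: derivable_oo_LRcontinuousT => x; apply: ex_derive.
- by move=> x _; rewrite derive1E; exact: derive_val.
Qed.

(** The integrand is the chord length of the disc of radius [r], and the substitution is x = r sin
    y. As [Num.sqrt] is 0 on negative numbers, the integral may run over the whole line. *)
Lemma integral_disc_chord (t : R) : 0 < t ->
  (\int[mu]_x (2 * Num.sqrt (t - x ^+ 2))%:E = (pi * t)%:E)%E.
Proof.
move=> t0; set r := Num.sqrt t.
have r0 : 0 < r by rewrite sqrtr_gt0.
have r2 : r ^+ 2 = t by rewrite sqr_sqrtr// ltW.
pose F (x : R) : R := r * sin x.
have Fb : F (pi / 2) = r by rewrite /F sin_pihalf mulr1.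
have Fa : F (- (pi / 2)) = - r by rewrite /F sinN sin_pihalf mulrN1.
have dF (x : R) : is_derive x 1 F (r * cos x).
  by apply: is_derive_eq; rewrite /GRing.scale/=; ring.
have F' : (F^`())%classic = (fun x => r * cos x).
  by apply/funext => x; rewrite derive1E; exact: derive_val.
have cF' : continuous (fun x : R => r * cos x).
  by move=> x; apply: cvgM; [exact: cvg_cst|exact: continuous_cos].
have pi2 : 0 < pi / 2 :> R by rewrite divr_gt0// pi_gt0.
transitivity (\int[mu]_(x in `[F (- (pi / 2))%R, F (pi / 2)%R])
    (2 * Num.sqrt (t - x ^+ 2))%:E)%E.
  rewrite [RHS]integral_mkcond; apply: eq_integral => x _.
  rewrite patchE; case: ifPn => //; rewrite notin_setE/= Fa Fb in_itv/= -ler_norml.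
  move=> /negP; rewrite -ltNge => rx.
  rewrite ler0_sqrtr ?mulr0// subr_le0 -r2 -[leRHS]real_normK ?num_real//.
  by apply: lerXn2r; rewrite ?nnegrE ?normr_ge0 ?(ltW rx) ?(ltW r0).
rewrite (@integration_by_substitution_increasing _ F (fun x => 2 * Num.sqrt (t - x ^+ 2))).
- transitivity (\int[mu]_(x in `[(- (pi / 2))%R, (pi / 2)%R]) (t%:E * (2 * cos x ^+ 2)%:E))%E.
    apply: eq_integral => x; rewrite inE/= in_itv/= => xpi.
    rewrite F' /= -EFinM; congr EFin; rewrite /F /= fctE /=.
    have -> : t - (r * sin x) ^+ 2 = (r * cos x) ^+ 2.
      by rewrite -r2 !exprMn sin2cos2; ring.
    rewrite sqrtr_sqr ger0_norm ?mulr_ge0 ?(ltW r0) ?cos_ge0_pihalf//.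
    by rewrite -r2; ring.
  rewrite ge0_integralZl//=.
  + by rewrite integral_cos_sqr -EFinM mulrC.
  + apply/measurable_EFinP; apply: measurable_funTS; apply: continuous_measurable_fun.
    by move=> x; apply: cvgM; [exact: cvg_cst|apply: cvgM; exact: continuous_cos].
  + by move=> x _; rewrite lee_fin mulr_ge0// sqr_ge0.
  + by rewrite lee_fin ltW.
- by lra.
- by move=> x y xi yi xy; rewrite /F ltr_pM2l// ltr_sin.
- by rewrite F'; move=> x _; exact: cF'.
- by rewrite F'; apply/cvg_ex; eexists; apply: cvg_at_right_filter; exact: cF'.
- by rewrite F'; apply/cvg_ex; eexists; apply: cvg_at_left_filter; exact: cF'.
- by apply: derivable_oo_LRcontinuousT => x; apply: ex_derive.
- apply: continuous_subspaceT => x; apply: cvgM; first exact: cvg_cst.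
  apply: (@cvg_comp _ _ _ (fun x : R => t - x ^+ 2) Num.sqrt); last exact: sqrt_continuous.
  by apply: cvgB; [exact: cvg_cst|exact: sqr_continuous].
Qed.

End disc_area.

(** * Probability that a complex Gaussian falls in a disc *)

Section disc_probability.
Context {R : realType} {d : measure_display} {T : measurableType d}.
Variables (P : probability T R).
Local Notation mu := (@lebesgue_measure R).
Local Notation s0 := (Num.sqrt (2^-1 : R)).
Local Open Scope ereal_scope.

Lemma lebesgue_measure_sqr_lt (u : R) :
  mu [set y : R | (y ^+ 2 < u)%R] = (2 * Num.sqrt u)%:E.
Proof.
have [u0|u0] := ltP 0%R u; last first.
  rewrite ler0_sqrtr// mulr0 [X in mu X](_ : _ = set0) ?measure0//.
  by apply/seteqP; split => // y /= /lt_le_trans /(_ u0); rewrite ltNge sqr_ge0.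
have su : (0 < Num.sqrt u)%R by rewrite sqrtr_gt0.
rewrite [X in mu X](_ : _ = [set` `](- Num.sqrt u)%R, (Num.sqrt u)%R[ ]); last first.
  apply/seteqP; split => y /=; rewrite in_itv/= -ltr_norml -sqrtr_sqr ltr_sqrt//.
rewrite lebesgue_measure_itv/= lte_fin gtrN// -EFinB opprK; congr EFin; ring.
Qed.

Lemma ge0_integral_normal_law (U : {mfun T >-> R}) (f : R -> \bar R) :
  has_normal_law P U 0 s0 ->
  measurable_fun setT f -> (forall x, 0 <= f x) ->
  \int[distribution P U]_x f x = \int[normal_prob 0 s0]_x f x.
Proof.
move=> lU mf f0.
(* [R] and [measurableTypeR R], the domain of [lebesgue_measure], have the same
   measurable sets but different displays. *)
have mU : measurable_fun setT (U : T -> measurableTypeR R).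
  by have mU0 : measurable_fun setT (U : T -> R) by []; exact: mU0.
have mf' : measurable_fun [set: measurableTypeR R] f by exact: mf.
rewrite ge0_integral_distribution//.
transitivity (\int[pushforward P (U : T -> measurableTypeR R)]_x f x).
  by rewrite ge0_integral_pushforward//.
apply: eq_measure_integral => A mA _; exact: lU.
Qed.

Lemma integral_normal_law_bounded (U : {mfun T >-> R}) (f : R -> \bar R) :
  has_normal_law P U 0 s0 ->
  measurable_fun setT f -> (forall x, 0 <= f x <= 1) ->
  \int[distribution P U]_x f x = \int[mu]_x (f x * (normal_pdf 0 s0 x)%:E).
Proof.
move=> lU mf f01; rewrite ge0_integral_normal_law//; last first.
  by move=> x; case/andP: (f01 x).
have mf' : measurable_fun [set: measurableTypeR R] f by exact: mf.
rewrite integral_normal_prob//.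
apply: (@le_integrable _ _ _ _ _ measurableT _ (cst 1)) => //.
- by move=> x _; have /andP[f0 f1] := f01 x; rewrite gee0_abs// gee0_abs.
- exact: finite_measure_integrable_cst.
Qed.

Lemma measurable_disc (t : R) :
  measurable [set z : R * R | (z.1 ^+ 2 + z.2 ^+ 2 < t)%R].
Proof.
have -> : [set z : R * R | (z.1 ^+ 2 + z.2 ^+ 2 < t)%R] =
  setT `&` (fun z : R * R => z.1 ^+ 2 + z.2 ^+ 2)%R @^-1` `]-oo, t[%classic.
  by rewrite setTI; apply/seteqP; split => z /=; rewrite in_itv.
have : measurable_fun setT (fun z : R * R => (z.1 ^+ 2 + z.2 ^+ 2)%R).
  by apply: measurable_funD; apply: measurable_funX.
by apply => //; exact: measurable_itv.
Qed.

Definition disc (t : R) := [set z : R * R | (z.1 ^+ 2 + z.2 ^+ 2 < t)%R].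

(** The two densities of variance 1/2 multiply to the rotation-invariant density
    [pi^-1 * expR (- |z|^2)]. *)
Lemma disc_probability (U V : {mfun T >-> R}) (t : R) :
  has_normal_law P U 0 s0 -> has_normal_law P V 0 s0 ->
  indep2 P U V ->
  P [set w | (U w ^+ 2 + V w ^+ 2 < t)%R] =
  \int[mu \x mu]_z
     (\1_(disc t) z * (pi^-1 * expR (- (z.1 ^+ 2 + z.2 ^+ 2))))%:E.
Proof.
move=> lU lV UV.
have mD : measurable (disc t) by exact: measurable_disc.
pose h (z : R * R) := (\1_(disc t) z : R)%:E.
have h01 z : 0 <= h z <= 1.
  by rewrite /h indicE; case: (_ \in _); rewrite !lee_fin ?lexx ?ler01.
have mh : measurable_fun [set: R * R] h.
  by apply/measurable_EFinP; exact: measurable_indic.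
have h0 z : 0 <= h z by case/andP: (h01 z).
have mhx x : measurable_fun [set: R] (fun y => h (x, y)).
  exact: measurableT_comp.
have mE : measurable [set w | (U w ^+ 2 + V w ^+ 2 < t)%R].
  have mUV : measurable_fun setT (fun w => (U w, V w)) by exact: measurable_fun_pair.
  by have := mUV measurableT _ mD; rewrite setTI.
transitivity (\int[P]_w h (U w, V w)).
  by rewrite -[in LHS](setIT [set w | _]) -integral_indic.
rewrite fubini_tonelli1/=; first last.
- move=> z; rewrite lee_fin !mulr_ge0 ?invr_ge0 ?pi_ge0 ?expR_ge0//.
- apply/measurable_EFinP; apply: measurable_funM => //.
  apply: measurable_funM => //; apply: measurableT_comp => //.
  apply: measurableT_comp => //.
  by apply: measurable_funD; apply: measurable_funX.
rewrite indep2_integral// integral_normal_law_bounded//.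
- apply: eq_integral => x _; rewrite integral_normal_law_bounded// muleC -ge0_integralZl//; first last.
  + by rewrite lee_fin normal_pdf_ge0.
  + by move=> y _; rewrite mule_ge0// lee_fin normal_pdf_ge0.
  + apply: emeasurable_funM; first exact: mhx.
    by apply/measurable_EFinP; exact: measurable_normal_pdf.
  apply: eq_integral => y _; rewrite /h !normal_pdf_half -!EFinM; congr EFin.
  rewrite mulrCA; congr (_ * _)%R.
  by rewrite opprD expRD mulrACA -invfM -expr2 sqr_sqrtr ?pi_ge0.
- exact: (@measurable_fun_fubini_tonelli_F _ _ _ _ _ (distribution P V) h mh h0).
- move=> x; apply/andP; split; first by apply: integral_ge0.
  rewrite -[leRHS](@probability_setT _ _ _ (distribution P V)) -[leRHS]mul1e.
  rewrite -integral_cst//.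
  apply: ge0_le_integral => //= y _.
  by case/andP: (h01 (x, y)).
Qed.

Lemma disc_area (t : R) : (0 < t)%R ->
  \int[mu \x mu]_z (\1_(disc t) z)%:E = (pi * t)%:E.
Proof.
move=> t0; have mD : measurable (disc t) by exact: measurable_disc.
rewrite fubini_tonelli1/=; first last.
- by move=> z; rewrite lee_fin.
- by apply/measurable_EFinP; exact: measurable_indic.
rewrite -integral_disc_chord//; apply: eq_integral => x _.
rewrite -lebesgue_measure_sqr_lt.
rewrite -[in RHS](setIT [set y | _]) -integral_indic//.
  apply: eq_integral => y _; congr EFin; rewrite !indicE; congr (_%:R).
  by congr nat_of_bool; apply/idP/idP; rewrite !inE /disc/= ltrBrDl.
rewrite -[X in measurable X]setTI.
have : measurable_fun setT (fun y : R => (y ^+ 2)%R) by exact: measurable_funX.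
move=> /(_ measurableT `]-oo, (t - x ^+ 2)%R[%classic (measurable_itv _)).
by congr measurable; apply/seteqP; split => y /=; rewrite in_itv.
Qed.

(** On a disc of area [pi * t] the density lies between [expR (- t) / pi] and [1 / pi]. *)
Lemma disc_probability_bounds (U V : {mfun T >-> R}) (t : R) : (0 < t)%R ->
  has_normal_law P U 0 s0 -> has_normal_law P V 0 s0 ->
  indep2 P U V ->
  (t * expR (- t))%:E <= P [set w | (U w ^+ 2 + V w ^+ 2 < t)%R] <= t%:E.
Proof.
move=> t0 lU lV UV; rewrite disc_probability//.
have pi0 : (0 < pi :> R)%R by exact: pi_gt0.
have mD : measurable (disc t) by exact: measurable_disc.
have m1 : measurable_fun setT (\1_(disc t) : R * R -> R) by exact: measurable_indic.
have const_disc (c : R) : (0 <= c)%R ->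
    \int[mu \x mu]_z (\1_(disc t) z * (pi^-1 * c))%:E = (t * c)%:E.
  move=> c0; under eq_integral do rewrite EFinM.
  rewrite ge0_integralZr//=.
  - by rewrite disc_area// -EFinM mulrACA divff ?mul1r// gt_eqF.
  - by apply/measurable_EFinP; exact: m1.
  - by rewrite lee_fin mulr_ge0// invr_ge0 ltW.
have mexp : measurable_fun setT (fun z : R * R =>
    (\1_(disc t) z * (pi^-1 * expR (- (z.1 ^+ 2 + z.2 ^+ 2))))%:E).
  apply/measurable_EFinP; apply: measurable_funM => //.
  apply: measurable_funM => //; apply: measurableT_comp => //.
  apply: measurableT_comp => //.
  by apply: measurable_funD; apply: measurable_funX.
apply/andP; split.
- rewrite -const_disc ?expR_ge0//; apply: ge0_le_integral => //=.
  + by move=> z _; rewrite lee_fin !mulr_ge0 ?invr_ge0 ?expR_ge0 ?(ltW pi0).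
  + by apply/measurable_EFinP; apply: measurable_funM => //; exact: m1.
  + move=> z _; rewrite lee_fin indicE.
    case: (boolP (z \in disc t)) => [|_]; last by rewrite !mul0r.
    rewrite inE/= => zt; rewrite !mul1r ler_pM2l ?invr_gt0// ler_expR lerN2.
    exact: ltW.
- rewrite -[t in leRHS]mulr1 -const_disc//; apply: ge0_le_integral => //=.
  + by move=> z _; rewrite lee_fin !mulr_ge0 ?invr_ge0 ?expR_ge0 ?(ltW pi0).
  + by apply/measurable_EFinP; apply: measurable_funM => //; exact: m1.
  + move=> z _; rewrite lee_fin ler_wpM2l// ler_wpM2l ?invr_ge0 ?(ltW pi0)//.
    by rewrite -expR0 ler_expR oppr_le0 addr_ge0// sqr_ge0.
Qed.

End disc_probability.

(** * Small values of a product of independent variables *)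

Section product_small_ball.
Context {R : realType} {d : measure_display} {T : measurableType d}.
Variables (P : probability T R).
Local Notation mu := (@lebesgue_measure R).
Local Open Scope ereal_scope.

Lemma integral_expR_itv (s0 x : R) : (0 < s0)%R -> (0 < x)%R ->
  \int[mu]_(s in `[0%R, s0]) (expR (- (s * x)))%:E =
  ((1 - expR (- (s0 * x))) / x)%:E.
Proof.
move=> s00 x0.
have D (s : R) : is_derive s 1%R (fun s : R => (- (expR (- (s * x)) / x))%R) (expR (- (s * x)))%R.
  apply: is_derive_eq; rewrite /GRing.scale/=; field; exact: lt0r_neq0.
rewrite (@continuous_FTC2 _ _ (fun s : R => (- (expR (- (s * x)) / x))%R))//.
- rewrite mul0r oppr0 expR0 -EFinB; congr EFin; field; exact: lt0r_neq0.
- apply: continuous_subspaceT => s.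
  apply: (@cvg_comp _ _ _ (fun s : R => - (s * x))%R expR); last exact: continuous_expR.
  by apply: cvgN; apply: cvgM; [exact: cvg_id|exact: cvg_cst].
- by apply: derivable_oo_LRcontinuousT => s; apply: ex_derive.
- by move=> s _; rewrite derive1E; exact: derive_val.
Qed.

(* Both bounds on [G] come from the convex combination of [e / x] and [1] with
   weights [1 - E] and [E], where [E := expR (- (s0 * x))]. *)
Lemma small_ball_kernel_bounds (e s0 x G : R) : (0 < e)%R -> (0 < s0)%R -> (0 < x)%R ->
  let K := ((1 - expR (- (s0 * x))) / x)%R in
  let M := (e * K + expR (- (s0 * x)))%R in
  (e / x * expR (- (e / x)) <= G)%R -> (G <= e / x)%R -> (G <= 1)%R ->
  (G <= M)%R /\ (e * K <= G + e * s0 * M)%R.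
Proof.
move=> e0 s00 x0 K M G1 G2 G3.
set E := expR (- (s0 * x)) in K M *.
have E0 : (0 <= E)%R by exact: expR_ge0.
have E1 : (E <= 1)%R.
  by rewrite -expR0 ler_expR oppr_le0 mulr_ge0// ltW.
set u := (e / x)%R in G1 G2 *.
have u0 : (0 < u)%R by rewrite divr_gt0.
have eK : (e * K = u * (1 - E))%R by rewrite /K /u; field; exact: lt0r_neq0.
have convexity m : (m <= u -> m <= 1 -> m <= M)%R.
  move=> mu m1; rewrite /M eK.
  have : (0 <= (u - m) * (1 - E) + (1 - m) * E)%R.
    by rewrite addr_ge0// mulr_ge0// subr_ge0.
  by lra.
split; first exact: convexity.
have v1 := expR_ge1Dx (- u)%R; set v := expR (- u) in G1 v1 *.
have v0 : (0 <= v)%R by exact: expR_ge0.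
(* Both [1 - v <= u] and [1 - v <= 1] hold, so the convexity bound covers this quantity too. *)
have vM : (1 - v <= M)%R by apply: convexity; lra.
have E2 : (1 - E <= s0 * x)%R by have := expR_ge1Dx (- (s0 * x))%R; rewrite -/E; lra.
(* Split [u * (1 - E)] with the weights [v] and [1 - v]: the first part is at most [u * v], hence at
   most [G], and the second is the error estimated in [h2]. *)
have h1 : (u * (1 - E) <= u * v + u * (1 - E) * (1 - v))%R.
  have : (0 <= u * (E * v))%R by apply: mulr_ge0; [exact: ltW|exact: mulr_ge0].
  by nra.
have h2 : (u * (1 - E) * (1 - v) <= u * (s0 * x) * M)%R.
  apply: (@le_trans _ _ (u * (1 - E) * M)%R).
    by apply: ler_wpM2l vM; apply: mulr_ge0; [exact: ltW|rewrite subr_ge0].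
  apply: ler_wpM2r; last by apply: ler_wpM2l E2; exact: ltW.
  by apply: le_trans vM; rewrite subr_ge0 -expR0 ler_expR oppr_le0 ltW.
have h3 : (u * (s0 * x) = e * s0)%R by rewrite /u; field; exact: lt0r_neq0.
rewrite eK; rewrite h3 in h2; lra.
Qed.

Variables (S Q : {mfun T >-> R}) (phi : R -> R) (L s0 e : R).
Hypothesis S0 : forall w, (0 <= S w)%R.
Hypothesis SQ : indep2 P S Q.
Hypothesis Qlaw : forall t, (0 < t)%R ->
  (t * expR (- t))%:E <= P [set w | (Q w < t)%R] <= t%:E.
Hypothesis laplaceS : forall s, (0 <= s)%R ->
  \int[P]_w (expR (- (s * S w)))%:E = (phi s)%:E.
Hypothesis s0_gt0 : (0 < s0)%R.
Hypothesis Lphi : \int[mu]_(s in `[0%R, s0]) (phi s)%:E = L%:E.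
Hypothesis e_gt0 : (0 < e)%R.

(** A truncation of 1/x: it equals [s0] at x = 0, where 1/x blows up, and differs from 1/x by
    [expR (- (s0 * x)) / x] for x > 0. *)
Let K (x : R) := \int[mu]_(s in `[0%R, s0]) (expR (- (s * x)))%:E.

Let f (z : R * R) : \bar R := (expR (- (z.2 * z.1)) * \1_(`[0%R, s0]%classic) z.2)%:E.

Let mf : measurable_fun [set: R * R] f.
Proof.
apply/measurable_EFinP; apply: measurable_funM.
  apply: measurableT_comp => //; apply: measurableT_comp => //.
  exact: measurable_funM.
by apply: (@measurableT_comp _ _ _ _ _ _ (\1_(`[0%R, s0]%classic) : R -> R)).
Qed.

Let f0 z : 0 <= f z.
Proof. by rewrite lee_fin mulr_ge0// expR_ge0. Qed.

Let KE x : K x = \int[mu]_s f (x, s).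
Proof.
rewrite /K integral_mkcond; apply: eq_integral => s _.
rewrite patchE /f/= indicE; case: ifPn => _; rewrite ?mulr1// mulr0//.
Qed.

Let mK : measurable_fun setT K.
Proof.
have -> : K = fubini_F mu f by apply/funext => x; rewrite KE.
exact: (@measurable_fun_fubini_tonelli_F _ _ R (measurableTypeR R) R mu f).
Qed.

Let K_ge0 x : 0 <= K x.
Proof. by apply: integral_ge0 => s _; rewrite lee_fin expR_ge0. Qed.

(** Tonelli exchanges the expectation with the integral over s, and the inner expectation is the
    Laplace transform. So [L] is the truncated E(1/S). *)
Let integral_K : \int[P]_w K (S w) = L%:E.
Proof.
under eq_integral do rewrite KE.
have mg : measurable_fun setT (fun z : T * measurableTypeR R => f (S z.1, z.2)).
  apply: (@measurableT_comp _ _ _ _ _ _ f) => //.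
  apply: measurable_fun_pair => //.
  exact: measurableT_comp.
rewrite (@fubini_tonelli _ _ _ (measurableTypeR R) R P mu (fun z => f (S z.1, z.2)))//=.
rewrite -Lphi [RHS]integral_mkcond; apply: eq_integral => s _.
rewrite patchE /f/= indicE; case: ifPn.
  rewrite inE/= in_itv/= => /andP[s_ge0 _].
  by rewrite -laplaceS//; apply: eq_integral => w _; rewrite mulr1.
by move=> _; under eq_integral do rewrite mulr0; rewrite integral0.
Qed.

(** The conditional probability of the product event given S = x. *)
Let G (x : R) := P [set w | (x * Q w < e)%R].

Let measurable_lt : measurable [set z : R * R | (z.1 * z.2 < e)%R].
Proof.
have : measurable_fun setT (fun z : R * R => (z.1 * z.2)%R) by exact: measurable_funM.
move=> /(_ measurableT `]-oo, e[%classic (measurable_itv _)); rewrite setTI.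
by congr measurable; apply/seteqP; split => z /=; rewrite in_itv.
Qed.

Let h (z : R * R) : \bar R := (\1_[set z : R * R | (z.1 * z.2 < e)%R] z : R)%:E.

Let mh : measurable_fun [set: R * R] h.
Proof. by apply/measurable_EFinP; exact: measurable_indic. Qed.

Let h0 z : 0 <= h z. Proof. by rewrite lee_fin. Qed.

Let mult_lt x : measurable [set q : R | (x * q < e)%R].
Proof.
have : measurable_fun setT (fun q : R => (x * q)%R) by exact: measurable_funM.
move=> /(_ measurableT `]-oo, e[%classic (measurable_itv _)); rewrite setTI.
by congr measurable; apply/seteqP; split => z /=; rewrite in_itv.
Qed.

Let GE x : G x = \int[distribution P Q]_q h (x, q).
Proof.
rewrite /G -[LHS]/(distribution P Q [set q | (x * q < e)%R]).
by rewrite -[X in distribution _ _ X]setIT -integral_indic.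
Qed.

Let mG : measurable_fun setT G.
Proof.
have -> : G = fubini_F (distribution P Q) h by apply/funext => x; rewrite GE.
exact: measurable_fun_fubini_tonelli_F.
Qed.

Let measurable_G x : measurable [set w | (x * Q w < e)%R].
Proof. by have := measurable_funPT Q measurableT _ (mult_lt x); rewrite setTI. Qed.

Let G_ge0 x : 0 <= G x. Proof. exact: measure_ge0. Qed.

Let integral_G : \int[P]_w G (S w) = P [set w | (S w * Q w < e)%R].
Proof.
transitivity (\int[distribution P S]_x G x).
  by rewrite ge0_integral_distribution.
under eq_integral do rewrite GE.
rewrite -indep2_integral//.
have mE : measurable [set w | (S w * Q w < e)%R].
  have mUV : measurable_fun setT (fun w => (S w, Q w)) by exact: measurable_fun_pair.
  by have := mUV measurableT _ measurable_lt; rewrite setTI.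
by rewrite -[in RHS](setIT [set w | _]) -integral_indic.
Qed.

Let M (x : R) := e%:E * K x + (expR (- (s0 * x)))%:E.

Let kernel_bounds x : (0 <= x)%R ->
  G x <= M x /\ e%:E * K x <= G x + (e * s0)%:E * M x.
Proof.
rewrite le_eqVlt => /predU1P[<-|x0].
  (* [S] is only known to be nonnegative, so x = 0 gets its own check: there [G] is 1, [K] is s0 and
     [M] is e s0 + 1. *)
  have K0 : K 0%R = s0%:E.
    rewrite /K; under eq_integral do rewrite mulr0 oppr0 expR0.
    by rewrite integral_cst//= mul1e lebesgue_measure_itv/= lte_fin s0_gt0 -EFinB subr0.
  have G0 : G 0%R = 1.
    rewrite /G [X in P X](_ : _ = setT) ?probability_setT//.
    by apply/seteqP; split => // w _ /=; rewrite mul0r.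
  rewrite /M K0 G0 mulr0 oppr0 expR0 -!EFinM -!EFinD !lee_fin.
  have es0 : (0 < e * s0)%R by rewrite mulr_gt0.
  by split; nra.
have GQ : G x = P [set w | (Q w < e / x)%R].
  by congr (P _); apply/seteqP; split => w /=; rewrite ltr_pdivlMr// mulrC.
have Gfin : (fine (G x))%:E = G x.
  by rewrite fineK// fin_num_measure.
have /andP[G1 G2] := Qlaw _ (divr_gt0 e_gt0 x0); rewrite -GQ -Gfin !lee_fin in G1 G2.
have G3 : (fine (G x) <= 1)%R by rewrite -lee_fin Gfin; exact: probability_le1.
have [] := @small_ball_kernel_bounds e s0 x _ e_gt0 s0_gt0 x0 G1 G2 G3.
rewrite /M /K integral_expR_itv// -Gfin -!EFinM -!EFinD !lee_fin.
by move=> ? ?; split.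
Qed.

Let mM : measurable_fun setT M.
Proof.
apply: emeasurable_funD; first exact: measurable_funeM.
apply/measurable_EFinP; apply: measurableT_comp => //; apply: measurableT_comp => //.
Qed.

Let M_ge0 x : 0 <= M x.
Proof. by rewrite adde_ge0 ?mule_ge0// lee_fin ?expR_ge0 ?ltW. Qed.

Let integral_M : \int[P]_w M (S w) = (e * L + phi s0)%:E.
Proof.
rewrite ge0_integralD//=.
- rewrite ge0_integralZl//=.
  + by rewrite integral_K laplaceS ?ltW// -EFinM -EFinD.
  + exact: (@measurableT_comp _ _ _ _ _ _ K).
  + by rewrite lee_fin ltW.
- by move=> w _; rewrite mule_ge0// lee_fin ltW.
- by apply: measurable_funeM; exact: (@measurableT_comp _ _ _ _ _ _ K).
- apply/measurable_EFinP; apply: measurableT_comp => //; apply: measurableT_comp => //.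
  exact: measurable_funM.
Qed.

Lemma product_small_ball_le :
  P [set w | (S w * Q w < e)%R] <= (e * L + phi s0)%:E.
Proof.
rewrite -integral_G -integral_M; apply: ge0_le_integral => //=.
- exact: (@measurableT_comp _ _ _ _ _ _ G).
- exact: (@measurableT_comp _ _ _ _ _ _ M).
- by move=> w _; case: (kernel_bounds _ (S0 w)).
Qed.

(** The second pointwise bound of [kernel_bounds], integrated against the law of [S]. The error
    carries the factor [e * s0], made small by a cut-off that is a small multiple of 1/e. *)
Lemma product_small_ball_ge :
  (e * L)%:E <= P [set w | (S w * Q w < e)%R] + (e * s0 * (e * L + phi s0))%:E.
Proof.
rewrite -integral_G [in leRHS]EFinM -integral_M EFinM -integral_K.
rewrite -ge0_integralZl//=; last 2 first.
- exact: (@measurableT_comp _ _ _ _ _ _ K).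
- by rewrite lee_fin ltW.
rewrite -ge0_integralZl//=; last 2 first.
- exact: (@measurableT_comp _ _ _ _ _ _ M).
- by rewrite lee_fin mulr_ge0// ltW.
have es0 : (0 <= e * s0)%R by rewrite mulr_ge0// ltW.
rewrite -ge0_integralD//=.
- apply: ge0_le_integral => //=.
  + by move=> w _; rewrite mule_ge0// lee_fin ltW.
  + by apply: measurable_funeM; exact: (@measurableT_comp _ _ _ _ _ _ K).
  + apply: emeasurable_funD; first exact: (@measurableT_comp _ _ _ _ _ _ G).
    by apply: measurable_funeM; exact: (@measurableT_comp _ _ _ _ _ _ M).
  + by move=> w _; case: (kernel_bounds _ (S0 w)).
- exact: (@measurableT_comp _ _ _ _ _ _ G).
- by move=> w _; rewrite mule_ge0.
- by apply: measurable_funeM; exact: (@measurableT_comp _ _ _ _ _ _ M).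
Qed.

End product_small_ball.

(** * Squared moduli of independent complex Gaussians *)

Section gaussian_families.
Context {R : realType} {d : measure_display} {T : measurableType d}.
Variables (P : probability T R).
Local Open Scope ereal_scope.

Definition mfun_of (U : T -> R) (mU : measurable_fun setT U) : {mfun T >-> R} :=
  HB.pack U (isMeasurableFun.Build _ _ _ _ U mU).

Lemma indep2_integralM (U V : {mfun T >-> R}) (f g : R -> R) :
  indep2 P U V -> measurable_fun setT f -> measurable_fun setT g ->
  (forall x, 0 <= f x)%R -> (forall x, 0 <= g x)%R ->
  \int[P]_w (f (U w) * g (V w))%:E =
  (\int[P]_w (f (U w))%:E) * \int[P]_w (g (V w))%:E.
Proof.
move=> UV mf mg f0 g0.
rewrite (indep2_integral _ _ _ (fun z => (f z.1 * g z.2)%:E))//; first last.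
- by move=> z; rewrite lee_fin mulr_ge0.
- apply/measurable_EFinP; apply: measurable_funM.
    exact: (@measurableT_comp _ _ _ _ _ _ f).
  exact: (@measurableT_comp _ _ _ _ _ _ g).
have mEf : measurable_fun setT (EFin \o f) by exact/measurable_EFinP.
have mEg : measurable_fun setT (EFin \o g) by exact/measurable_EFinP.
under eq_integral => x _.
  under eq_integral => y _ do rewrite /= EFinM.
  rewrite ge0_integralZl//=; [|by move=> y _; rewrite lee_fin|by rewrite lee_fin].
  over.
rewrite ge0_integralZr//=; first last.
- by apply: integral_ge0 => y _; rewrite lee_fin.
- by move=> x _; rewrite lee_fin.
by rewrite !ge0_integral_distribution// => x; rewrite lee_fin.
Qed.

Variables (I : finType) (W : I -> bool -> T -> R).
Hypothesis mW : forall k b, measurable_fun setT (W k b).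
Hypothesis HW : iid_CSCG P W.

Let X (kb : I * bool) := W kb.1 kb.2.
Let mX kb : measurable_fun setT (X kb). Proof. exact: mW. Qed.

Lemma measurable_sqmod k : measurable_fun setT (sqmod W k).
Proof. by apply: measurable_funD; apply: measurable_funX. Qed.

Lemma sqmod_ge0 k w : (0 <= sqmod W k w)%R.
Proof. by rewrite addr_ge0// sqr_ge0. Qed.

Lemma depends_on_sqmod (J : pred I) k : J k ->
  depends_on X [pred kb | J kb.1] (sqmod W k).
Proof.
move=> Jk; apply: measurable_funD; apply: measurable_funX.
- exact: (@depends_on_coord _ _ _ _ X [pred kb | J kb.1] (k, true)).
- exact: (@depends_on_coord _ _ _ _ X [pred kb | J kb.1] (k, false)).
Qed.

Lemma depends_on_comb (J : pred I) (K : Type) (emb : K -> I) (r : seq K) (c : K -> R) :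
  all (J \o emb) r ->
  depends_on X [pred kb | J kb.1] (fun w => \sum_(i <- r) c i * sqmod W (emb i) w)%R.
Proof.
elim: r => [_|i r IH /= /andP[Ji Jr]].
  rewrite [X in depends_on _ _ X](_ : _ = cst 0%R); first exact: measurable_cst.
  by apply/funext => w; rewrite big_nil.
rewrite [X in depends_on _ _ X](_ : _ = (fun w => c i * sqmod W (emb i) w +
    \sum_(j <- r) c j * sqmod W (emb j) w)%R); last first.
  by apply/funext => w; rewrite big_cons.
apply: measurable_funD; last exact: IH.
by apply: measurable_funM => //; exact: depends_on_sqmod.
Qed.

Lemma indep2_groups (J1 J2 : pred I) U V : (forall k, J1 k -> ~~ J2 k) ->
  depends_on X [pred kb | J1 kb.1] U -> depends_on X [pred kb | J2 kb.1] V ->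
  indep2 P U V.
Proof.
move=> J12; case: HW => iX _; apply: depends_on_indep2 => //.
by move=> kb; exact: J12.
Qed.

Lemma indep2_re_im k : indep2 P (W k true) (W k false).
Proof.
case: HW => iX _.
apply: (@depends_on_indep2 _ _ _ _ _ X (pred1 (k, true)) (pred1 (k, false))) => //.
- by move=> i /eqP ->; rewrite /= xpair_eqE andbF.
- exact: (@depends_on_coord _ _ _ _ X (pred1 (k, true)) (k, true) (eqxx _)).
- exact: (@depends_on_coord _ _ _ _ X (pred1 (k, false)) (k, false) (eqxx _)).
Qed.

Lemma sqmod_law_bounds k t : (0 < t)%R ->
  (t * expR (- t))%:E <= P [set w | (sqmod W k w < t)%R] <= t%:E.
Proof.
case: HW => _ lW t0.
apply: (@disc_probability_bounds _ _ _ P (mfun_of _ (mW k true)) (mfun_of _ (mW k false))) => //.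
- exact: lW.
- exact: lW.
- exact: indep2_re_im.
Qed.

Lemma laplace_normal k b s : (0 <= s)%R ->
  \int[P]_w (expR (- (s * W k b w ^+ 2)))%:E = ((Num.sqrt (1 + s))^-1)%:E.
Proof.
move=> s0; case: HW => _ lW.
have mexp : measurable_fun setT (fun x : R => (expR (- (s * x ^+ 2)))%:E).
  apply/measurable_EFinP.
  apply: measurableT_comp => //; apply: measurableT_comp => //.
  by apply: measurable_funM => //; exact: measurable_funX.
rewrite -normal_half_laplace//.
rewrite -(@ge0_integral_normal_law _ _ _ P (mfun_of _ (mW k b)))//.
- by rewrite ge0_integral_distribution// => x; rewrite lee_fin expR_ge0.
- exact: lW.
Qed.

(** The real and imaginary parts are independent and contribute [(1 + s)^(-1/2)] each. *)
Lemma laplace_sqmod k s : (0 <= s)%R ->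
  \int[P]_w (expR (- (s * sqmod W k w)))%:E = ((1 + s)^-1)%:E.
Proof.
move=> s0.
have mexp : measurable_fun setT (fun x : R => expR (- (s * x ^+ 2))).
  apply: measurableT_comp => //; apply: measurableT_comp => //.
  by apply: measurable_funM => //; exact: measurable_funX.
under eq_integral => w _ do rewrite /sqmod mulrDr opprD expRD.
rewrite (@indep2_integralM (mfun_of _ (mW k true)) (mfun_of _ (mW k false))
  (fun x => expR (- (s * x ^+ 2))) (fun x => expR (- (s * x ^+ 2))))//=.
- rewrite !laplace_normal// -EFinM -invfM -expr2 sqr_sqrtr// addr_ge0//.
- exact: indep2_re_im.
Qed.

(** Induction on the list: injectivity of [emb] and [uniq r] keep the coordinates of the head
    disjoint from those of the tail, so the exponential factors. *)
Lemma laplace_comb (K : eqType) (emb : K -> I) (r : seq K) (c : K -> R) s :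
  injective emb -> uniq r -> (forall i, 0 <= c i)%R -> (0 <= s)%R ->
  \int[P]_w (expR (- (s * \sum_(i <- r) c i * sqmod W (emb i) w)))%:E =
  (\prod_(i <- r) (1 + c i * s)^-1)%:E.
Proof.
move=> emb_inj; elim: r => [_ c0 s0|i r IH /= /andP[ir ur] c0 s0].
  under eq_integral => w _ do rewrite big_nil mulr0 oppr0 expR0.
  rewrite big_nil integral_cst// mul1e.
  exact: probability_setT.
have iS : indep2 P (sqmod W (emb i)) (fun w => \sum_(i <- r) c i * sqmod W (emb i) w)%R.
  apply: (@indep2_groups (pred1 (emb i)) [pred k | k \in map emb r]).
  - by move=> k /eqP ->; rewrite /= mem_map.
  - by apply: depends_on_sqmod; rewrite /= eqxx.
  - by apply: depends_on_comb; apply/allP => j jr /=; rewrite map_f.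
have mS : measurable_fun setT (fun w => \sum_(i <- r) c i * sqmod W (emb i) w)%R.
  by apply: measurable_sum => j; apply: measurable_funM => //; exact: measurable_sqmod.
under eq_integral => w _ do rewrite big_cons mulrDr opprD expRD mulrCA mulrA.
rewrite (@indep2_integralM (mfun_of _ (measurable_sqmod (emb i))) (mfun_of _ mS)
  (fun x => expR (- (c i * s * x))) (fun x => expR (- (s * x))))//=.
- by rewrite laplace_sqmod ?mulr_ge0// IH// big_cons -EFinM.
- by apply: measurableT_comp => //; apply: measurableT_comp.
- by apply: measurableT_comp => //; apply: measurableT_comp.
Qed.

End gaussian_families.

(** * Partial fractions and the primitive of the Laplace transform *)

Section partial_fractions.
Context {R : realType} {N : nat} (lam : 'I_N -> R).
Hypothesis N_gt0 : (0 < N)%N.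
Hypothesis lam_pos : forall i, 0 < lam i.
Hypothesis lam_distinct : forall i j : 'I_N, i != j -> lam i != lam j.

Let lam_neq0 i : lam i != 0. Proof. by rewrite gt_eqF. Qed.

(** The exponent is an integer because N - 2 is -1 for N = 1, where natural subtraction would give
    0. The coefficient of [(1 + lam i * s)^-1] is [pf_coef i * lam i]. *)
Definition pf_coef (i : 'I_N) : R :=
  lam i ^ (N%:Z - 2) / (\prod_(j < N | j != i) (lam i - lam j)).

(** The cover-up rule: the product of the remaining factors, evaluated at the pole
    [- (lam i)^-1]. *)
Lemma pf_coefE i :
  pf_coef i * lam i = (\prod_(j < N | j != i) (1 - lam j / lam i))^-1.
Proof.
have -> : \prod_(j < N | j != i) (1 - lam j / lam i) =
    (\prod_(j < N | j != i) (lam i - lam j)) / lam i ^+ N.-1.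
  under eq_bigr => j _.
    have -> : 1 - lam j / lam i = (lam i - lam j) * (lam i)^-1.
      by rewrite mulrBl divff.
    over.
  rewrite big_split/=; congr (_ * _).
  rewrite prodr_const exprVn; congr (_ ^+ _)^-1.
  rewrite -[in RHS](card_ord N) -(cardC1 i); exact: eq_card.
rewrite invf_div /pf_coef mulrAC; congr (_ / _).
rewrite -{2}[lam i]expr1z -expfzDr//.
have -> : N%:Z - 2 + 1 = N.-1%:Z by rewrite -{1}(prednK N_gt0) -addn1 PoszD; ring.
by [].
Qed.

Lemma partial_fractions (s : R) : (forall i, 1 + lam i * s != 0) ->
  \prod_(i < N) (1 + lam i * s)^-1 =
  \sum_(i < N) pf_coef i * lam i / (1 + lam i * s).
Proof.
move=> s_neq0.
(* [p] has size at most [N] and the [N] distinct roots [- (lam i)^-1]. *)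
pose p : {poly R} := \sum_(i < N) (pf_coef i * lam i) *:
  (\prod_(j < N | j != i) (1 + lam j *: 'X)) - 1.
have sz1 (j : 'I_N) : (size (1 + lam j *: 'X : {poly R})%R <= 2)%N.
  rewrite (leq_trans (size_polyD _ _))// geq_max size_poly1/=.
  by rewrite (leq_trans (size_scale_leq _ _))// size_polyX.
have size_p : (size p <= N)%N.
  rewrite (leq_trans (size_polyD _ _))// geq_max size_polyN size_poly1 N_gt0 andbT.
  apply: (leq_trans (size_sum _ _ _)); apply/bigmax_leqP => i _.
  apply: (leq_trans (size_scale_leq _ _)).
  apply: (leq_trans (size_prod_leq _ _)); rewrite leq_subLR.
  have -> : #|(fun j : 'I_N => j != i)| = N.-1.
    by rewrite -[in RHS](card_ord N) -(cardC1 i); exact: eq_card.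
  apply: (@leq_trans (\sum_(j < N | j != i) 2).+1).
    by rewrite ltnS; apply: leq_sum.
  rewrite sum_nat_const.
  have -> : #|(fun j : 'I_N => j != i)| = N.-1.
    by rewrite -[in RHS](card_ord N) -(cardC1 i); exact: eq_card.
  by case: (N) N_gt0 => // n _ /=; rewrite muln2 -addnn addnS.
have root_p i : root p (- (lam i)^-1).
  (* At this point every summand but the one of index [i] contains a vanishing factor, and the
     surviving one equals 1 by [pf_coefE]. *)
  rewrite rootE /p !hornerE horner_sum (bigD1 i)//= [X in _ + X - 1]big1 ?addr0.
    rewrite !hornerE horner_prod pf_coefE.
    have -> : \prod_(j < N | j != i) (1 + lam j *: 'X).[- (lam i)^-1] =
        \prod_(j < N | j != i) (1 - lam j / lam i).
      by apply: eq_bigr => j _; rewrite !hornerE mulrN.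
    rewrite mulVf ?subrr//; apply/prodf_neq0 => j ji.
    rewrite subr_eq0 eq_sym; apply/eqP => /divr1_eq /eqP.
    by apply/negP; exact: lam_distinct.
  move=> k ki; rewrite !hornerE horner_prod (bigD1 i) 1?eq_sym//=.
  have -> : (1 + lam i *: 'X).[- (lam i)^-1] = 0.
    by rewrite !hornerE mulrN divff// subrr.
  by rewrite mul0r mulr0.
have p0 : p = 0.
  apply: (@roots_geq_poly_eq0 _ p [seq - (lam i)^-1 | i <- enum 'I_N]).
  - by apply/allP => _ /mapP[i _ ->].
  - rewrite map_inj_uniq ?enum_uniq// => i j /oppr_inj/invr_inj.
    by move=> lij; apply/eqP; apply: contraT => /lam_distinct; rewrite lij eqxx.
  - by rewrite size_map size_enum_ord.
have : p.[s] = 0 by rewrite p0 horner0.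
rewrite /p !hornerE horner_sum => /eqP; rewrite subr_eq0 => /eqP ps.
rewrite prodfV -[LHS]mul1r -[X in X * _]ps mulr_suml; apply: eq_bigr => i _.
rewrite !hornerE horner_prod (bigD1 (P := xpredT) i)//=.
have -> : \prod_(j < N | j != i) (1 + lam j *: 'X).[s] =
    \prod_(j < N | j != i) (1 + lam j * s).
  by apply: eq_bigr => j _; rewrite !hornerE.
have Q0 : \prod_(j < N | j != i) (1 + lam j * s) != 0 by exact/prodf_neq0.
by rewrite -mulf_div divff// mulr1.
Qed.

Local Notation mu := (@lebesgue_measure R).

(** The primitive of [laplace_prod] that vanishes at 0. *)
Definition log_sum (s : R) : R := \sum_(i < N) pf_coef i * ln (1 + lam i * s).

Definition laplace_prod (s : R) : R := \prod_(i < N) (1 + lam i * s)^-1.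

Let pos1 i s : 0 <= s -> 0 < 1 + lam i * s.
Proof. by move=> s0; rewrite ltr_wpDr// mulr_ge0// ltW. Qed.

Lemma laplace_prod_gt0 s : 0 <= s -> 0 < laplace_prod s.
Proof. by move=> s0; apply: prodr_gt0 => i _; rewrite invr_gt0 pos1. Qed.

Lemma is_derive_log_sum (s : R) : 0 <= s ->
  is_derive s 1 log_sum (laplace_prod s).
Proof.
move=> s0; have -> : log_sum = \sum_(i < N) (fun s => pf_coef i * ln (1 + lam i * s)).
  by apply/funext => x; rewrite fct_sumE.
rewrite /laplace_prod partial_fractions; last by move=> i; rewrite gt_eqF// pos1.
apply: is_derive_sum => i.
have D1 : is_derive s 1 (fun s => 1 + lam i * s) (lam i).
  by apply: is_derive_eq; rewrite /GRing.scale/=; ring.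
have D2 := is_derive1_ln (pos1 i s s0).
have D3 : is_derive s 1 (@ln R \o (fun s => 1 + lam i * s)) ((1 + lam i * s)^-1 * lam i).
  exact: is_derive1_comp.
rewrite [X in is_derive _ _ X](_ : _ = (fun s => pf_coef i * (@ln R \o (fun s => 1 + lam i * s)) s))//.
by apply: is_derive_eq; rewrite /GRing.scale/=; ring.
Qed.

Lemma continuous_laplace_prod (s : R) : 0 <= s ->
  laplace_prod x @[x --> s] --> laplace_prod s.
Proof.
move=> s0; rewrite /laplace_prod; move: (index_enum _) => r.
elim: r => [|i r IH].
  under eq_fun do rewrite big_nil; rewrite big_nil; exact: cvg_cst.
under eq_fun do rewrite big_cons; rewrite big_cons; apply: cvgM => //.
apply: cvgV; first by rewrite gt_eqF// pos1.
by apply: cvgD; [exact: cvg_cst|apply: cvgM; [exact: cvg_cst|exact: cvg_id]].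
Qed.

Lemma integral_laplace_prod (s0 : R) : 0 < s0 ->
  (\int[mu]_(s in `[0%R, s0]) (laplace_prod s)%:E = (log_sum s0)%:E)%E.
Proof.
move=> s00.
have cont s : 0 <= s -> {for s, continuous log_sum}.
  move=> s_ge0; apply: differentiable_continuous; apply/derivable1_diffP.
  by have := is_derive_log_sum s s_ge0; case.
rewrite (@continuous_FTC2 _ _ log_sum)//.
- by rewrite {2}/log_sum big1 ?sube0// => i _; rewrite mulr0 addr0 ln1 mulr0.
- apply/continuous_in_subspaceT => s; rewrite inE/= in_itv/= => /andP[s_ge0 _].
  exact: continuous_laplace_prod.
- split.
  + move=> s; rewrite in_itv/= => /andP[s_gt0 _].
    by have := is_derive_log_sum s (ltW s_gt0); case.
  + by apply: cvg_at_right_filter; apply: cont.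
  + by apply: cvg_at_left_filter; apply: cont; exact: ltW.
- move=> s; rewrite in_itv/= => /andP[s_gt0 _]; rewrite derive1E.
  by have := is_derive_log_sum s (ltW s_gt0); case.
Qed.

End partial_fractions.

(** * Limits at infinity and the abstract outage limit *)

Section limits.
Context {R : realType}.
Implicit Types f p v : R -> R.

Lemma cvg_of_eventual_bounds f (l : R) :
  (forall e, 0 < e -> \forall x \near +oo, f x <= l + e) ->
  (forall e, 0 < e -> \forall x \near +oo, l - e <= f x) ->
  f x @[x --> +oo] --> l.
Proof.
move=> fu fl; apply/cvgrPdist_le => e e0.
have := fu _ e0; have := fl _ e0; apply: filterS2 => x h1 h2.
by rewrite ler_distl; apply/andP; split; lra.
Qed.

Lemma near_le_of_cvg f (l a : R) : f x @[x --> +oo] --> l -> l < a ->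
  \forall x \near +oo, f x <= a.
Proof. by move=> fl la; exact: (cvgr_le _ fl). Qed.

Lemma near_ge_of_cvg f (l a : R) : f x @[x --> +oo] --> l -> a < l ->
  \forall x \near +oo, a <= f x.
Proof. by move=> fl la; exact: (cvgr_ge _ fl). Qed.

Lemma cvgV_pinfty f : f x @[x --> +oo] --> +oo -> (f x)^-1 @[x --> +oo] --> (0 : R).
Proof.
move=> foo; apply/(@gtr0_cvgV0 R R +oo _ f) => //.
by move/cvgryPgt : foo; exact.
Qed.

Lemma cvg_ln_pinfty : ln x @[x --> +oo] --> (+oo : set_system R).
Proof.
apply/cvgryPge => A.
have := nbhs_pinfty_ge (num_real (expR A)); apply: filterS => x Ax.
rewrite -[leLHS]expRK ler_ln ?posrE ?expR_gt0//.
exact: lt_le_trans (expR_gt0 _) Ax.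
Qed.

Lemma cvg_scale_pinfty (k : R) : 0 < k -> k * x @[x --> +oo%R] --> +oo%R.
Proof. by move=> k0; apply: gt0_cvgMry. Qed.

Lemma cvg_expRNV_pinfty (c : R) : expR (- (c / x)) @[x --> +oo] --> (1 : R).
Proof.
have -> : (1 : R) = expR (- (c * 0)) by rewrite mulr0 oppr0 expR0.
apply: (@cvg_comp _ _ _ (fun x : R => - (c / x)) expR); last exact: continuous_expR.
apply: cvgN; apply: cvgM; first exact: cvg_cst.
by apply: cvgV_pinfty.
Qed.

(** Chooses the relative loss [kap]; the sign of [c] is left free, whence the absolute value in the
    witness. *)
Lemma small_multiple (e c : R) : 0 < e -> exists2 k, 0 < k < 1 & k * c < e.
Proof.
move=> e0; have c0 := normr_ge0 c; have cc := ler_norm c.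
have D0 : 0 < e + `|c| + 1 by lra.
exists (e / (e + `|c| + 1)).
  by rewrite divr_gt0//= ltr_pdivrMr//; lra.
by rewrite mulrAC ltr_pdivrMr// ltr_pM2l//; lra.
Qed.

(* The weight [v] is [1] for [N >= 2] and [(ln rho)^-1] for [N = 1]. *)
Section outage_limit.
Variables (pS pX pY L phi v : R -> R) (pXY : R -> R -> R) (C Z l vinf : R).
Hypotheses (C0 : 0 < C) (Z0 : 0 < Z).
Hypothesis pX_bounds : forall t, 0 < t -> t * expR (- t) <= pX t <= t.
Hypothesis pY_le : forall e s, 0 < e -> 0 < s -> pY e <= e * L s + phi s.
Hypothesis pY_ge : forall e s, 0 < e -> 0 < s ->
  e * L s <= pY e + e * s * (e * L s + phi s).
Hypothesis pS_le : forall kap, 0 < kap -> exists m1 m2, [/\ 0 < m1, 0 < m2 &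
  forall rho, 0 < rho ->
    pS rho <= pX ((1 + kap) * C / rho) + pY ((1 + kap) * Z / rho)
              + pXY (m1 / rho) (m2 / rho)].
Hypothesis pS_ge : forall rho, 0 < rho ->
  pX (C / rho) + pY (Z / rho) <= pS rho + pXY (C / rho) (Z / rho).
Hypothesis v_gt0 : \forall rho \near +oo, 0 < v rho.
Hypothesis v_cvg : v rho @[rho --> +oo] --> vinf.
Hypothesis vL : forall k, 0 < k -> v rho * L (k * rho) @[rho --> +oo] --> l.
Hypothesis vphi : forall k, 0 < k ->
  v rho * (rho * phi (k * rho)) @[rho --> +oo] --> (0 : R).
Hypothesis vXY : forall m1 m2, 0 < m1 -> 0 < m2 ->
  v rho * (rho * pXY (m1 / rho) (m2 / rho)) @[rho --> +oo] --> (0 : R).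

(** For fixed [kap] the upper and lower bounds converge to limits within [e] of the target. Cut-offs
    proportional to rho make the hypotheses [vL] and [vphi] applicable. *)
Lemma outage_limit :
  v rho * (rho * pS rho) @[rho --> +oo] --> C * vinf + Z * l.
Proof.
set t := C * vinf + Z * l.
apply: cvg_of_eventual_bounds => e e0.
- have [kap /andP[kap0 _] kape] := small_multiple e t e0.
  have [m1 [m2 [m10 m20 pSk]]] := pS_le _ kap0.
  have kZ : 0 < (1 + kap) * Z by rewrite mulr_gt0// addr_gt0.
  have kC : 0 < (1 + kap) * C by rewrite mulr_gt0// addr_gt0.
  (* The cut-off [k * rho] is exactly 1/e for the threshold e = (1 + kap) Z / rho. *)
  pose k := ((1 + kap) * Z)^-1.
  have k0 : 0 < k by rewrite invr_gt0.
  pose u rho := (1 + kap) * C * v rho + (1 + kap) * Z * (v rho * L (k * rho))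
    + v rho * (rho * phi (k * rho)) + v rho * (rho * pXY (m1 / rho) (m2 / rho)).
  have ul : u rho @[rho --> +oo] --> (1 + kap) * C * vinf + (1 + kap) * Z * l + 0 + 0.
    apply: cvgD; last exact: vXY.
    apply: cvgD; last exact: vphi.
    by apply: cvgD; apply: cvgM => //; try exact: cvg_cst; exact: vL.
  have tu : (1 + kap) * C * vinf + (1 + kap) * Z * l + 0 + 0 < t + e.
    by move: kape; rewrite /t; lra.
  have := near_le_of_cvg _ _ _ ul tu; have := nbhs_pinfty_gt (num_real (0 : R)).
  move: v_gt0; apply: filterS3 => rho vr rho0; apply: le_trans.
  have -> : u rho = v rho * (rho * ((1 + kap) * C / rho + ((1 + kap) * Z / rho * L (k * rho) + phi (k * rho)) +
     pXY (m1 / rho) (m2 / rho))).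
    by rewrite /u; field; rewrite gt_eqF.
  rewrite ler_pM2l// ler_pM2l//; apply: (le_trans (pSk _ rho0)).
  rewrite lerD2r lerD//; last by apply: pY_le; [exact: divr_gt0|exact: mulr_gt0].
  by have /andP[] := pX_bounds _ (divr_gt0 kC rho0).
- have [kap /andP[kap0 kap1] kape] := small_multiple e (Z * l) e0.
  (* Now the threshold Z / rho times the cut-off [k * rho] is [kap], so the error in [pY_ge] costs
     only a fraction [kap] of the main term. *)
  pose k := kap / Z.
  have k0 : 0 < k by rewrite divr_gt0.
  pose u rho := C * expR (- (C / rho)) * v rho + (1 - kap) * Z * (v rho * L (k * rho))
    - kap * (v rho * (rho * phi (k * rho))) - v rho * (rho * pXY (C / rho) (Z / rho)).
  have ul : u rho @[rho --> +oo] --> C * 1 * vinf + (1 - kap) * Z * l - kap * 0 - 0.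
    apply: cvgB; last exact: vXY.
    apply: cvgB; last by apply: cvgM; [exact: cvg_cst|exact: vphi].
    apply: cvgD; apply: cvgM => //; [|exact: cvg_cst|exact: vL].
    apply: cvgM; first exact: cvg_cst.
    exact: cvg_expRNV_pinfty.
  have tu : t - e < C * 1 * vinf + (1 - kap) * Z * l - kap * 0 - 0.
    by move: kape; rewrite /t; lra.
  have := near_ge_of_cvg _ _ _ ul tu; have := nbhs_pinfty_gt (num_real (0 : R)).
  move: v_gt0; apply: filterS3 => rho vr rho0 /le_trans; apply.
  have -> : u rho = v rho * (rho * (C / rho * expR (- (C / rho)) + ((1 - kap) * (Z / rho * L (k * rho)) - kap * phi (k * rho)) -
     pXY (C / rho) (Z / rho))).
    by rewrite /u; field; rewrite gt_eqF.
  rewrite ler_pM2l// ler_pM2l// lerBlDr; apply: le_trans (pS_ge _ rho0).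
  apply: lerD; first by have /andP[] := pX_bounds _ (divr_gt0 C0 rho0).
  have := pY_ge (Z / rho) (k * rho) (divr_gt0 Z0 rho0) (mulr_gt0 k0 rho0).
  have -> : Z / rho * (k * rho) = kap by rewrite /k; field; rewrite !gt_eqF.
  by lra.
Qed.

End outage_limit.
End limits.

Lemma cvg_sum_seq {R : realType} (I : Type) (r : seq I) (f : I -> R -> R) (l : I -> R)
    (F : set_system R) : Filter F ->
  (forall i, f i x @[x --> F] --> l i) ->
  \sum_(i <- r) f i x @[x --> F] --> \sum_(i <- r) l i.
Proof.
move=> FF fl; elim: r => [|i r IH].
  under eq_fun do rewrite big_nil; rewrite big_nil; exact: cvg_cst.
by under eq_fun do rewrite big_cons; rewrite big_cons; exact: cvgD.
Qed.

Lemma cvg_affine_pinfty {R : realType} (k : R) : 0 < k ->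
  1 + k * x @[x --> +oo] --> (+oo : set_system R).
Proof.
move=> k0; apply/cvgryPge => A.
have := nbhs_pinfty_ge (num_real (A / k)); apply: filterS => x.
by rewrite ler_pdivrMr// mulrC => Ax; rewrite ler_wpDl.
Qed.

(** * Growth of the Laplace transform and of its primitive *)

Section asymptotics.
Context {R : realType} {N : nat} (lam : 'I_N -> R).
Hypothesis N_gt0 : (0 < N)%N.
Hypothesis lam_pos : forall i, 0 < lam i.
Hypothesis lam_distinct : forall i j : 'I_N, i != j -> lam i != lam j.

Local Notation c := (pf_coef lam).
Let sc := \sum_(i < N) c i.

(** After partial fractions each term is [c i * (1 - (1 + lam i * s)^-1)]. *)
Lemma mul_laplace_prod_cvg : s * laplace_prod lam s @[s --> +oo] --> sc.
Proof.
have -> : sc = \sum_(i < N) c i * (1 - 0) by apply: eq_bigr => i _; rewrite subr0 mulr1.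
have : \sum_(i < N) c i * (1 - (1 + lam i * s)^-1) @[s --> +oo] --> \sum_(i < N) c i * (1 - 0).
  apply: cvg_sum_seq => i; apply: cvgM; first exact: cvg_cst.
  apply: cvgB; first exact: cvg_cst.
  by apply: cvgV_pinfty; exact: cvg_affine_pinfty.
apply: cvg_trans; apply: near_eq_cvg.
have := nbhs_pinfty_gt (num_real (0 : R)); apply: filterS => s s0.
have s1 i : 1 + lam i * s != 0 by rewrite gt_eqF// addr_gt0// mulr_gt0.
rewrite /laplace_prod partial_fractions// mulr_sumr; apply: eq_bigr => i _.
by field; rewrite s1.
Qed.

(** Two factors already decay like s^(-2) and the others are at most 1, which forces
    [s * laplace_prod lam s] to 0 as soon as N >= 2. *)
Lemma laplace_prod_le (i j : 'I_N) s : i != j -> 0 < s ->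
  laplace_prod lam s <= (lam i * s)^-1 * (lam j * s)^-1.
Proof.
move=> ij s0; rewrite /laplace_prod (bigD1 i)//= (bigD1 j) ?(eq_sym j)//=.
have le1 k : (1 + lam k * s)^-1 <= 1.
  by rewrite invf_le1 ?lerDl ?addr_gt0 ?mulr_gt0// ltW// mulr_gt0.
have leV k : (1 + lam k * s)^-1 <= (lam k * s)^-1.
  by rewrite lef_pV2 ?posrE ?addr_gt0 ?mulr_gt0// lerDr.
have ge0 k : 0 <= (1 + lam k * s)^-1.
  by rewrite invr_ge0 ltW// addr_gt0// mulr_gt0.
apply: ler_pM => //; first by rewrite mulr_ge0// prodr_ge0.
apply: le_trans (leV j); rewrite -[leRHS]mulr1; apply: ler_wpM2l => //.
by apply: prodr_ile1 => k _; rewrite ge0 le1.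
Qed.

(* Both sides are the limit of [s * laplace_prod lam s] at infinity. *)
Lemma sum_pf_coef_eq0 : (1 < N)%N -> sc = 0.
Proof.
move=> N1; pose i := Ordinal N_gt0; pose j := Ordinal N1.
have ij : i != j by [].
apply: (@cvg_unique _ (@norm_hausdorff _ R) _ _ _ _ mul_laplace_prod_cvg).
apply: (@squeeze_cvgr _ _ _ _ (fun=> 0) (fun s => (lam i * lam j)^-1 * s^-1)).
- have := nbhs_pinfty_gt (num_real (0 : R)); apply: filterS => s s0.
  apply/andP; split.
    by rewrite mulr_ge0 ?(ltW s0)// ltW// laplace_prod_gt0// ltW.
  apply: (@le_trans _ _ (s * ((lam i * s)^-1 * (lam j * s)^-1))).
    by rewrite ler_pM2l// laplace_prod_le.
  by rewrite le_eqVlt; apply/orP; left; apply/eqP; field; rewrite !gt_eqF.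
- exact: cvg_cst.
- have : (lam i * lam j)^-1 * s^-1 @[s --> +oo] --> (lam i * lam j)^-1 * 0.
    by apply: cvgM; [exact: cvg_cst|exact: cvgV_pinfty].
  by rewrite mulr0.
Qed.

(** Isolates the possible divergence [sc * ln rho] from a remainder that converges. *)
Lemma log_sumE k rho : 0 < k -> 0 < rho ->
  log_sum lam (k * rho) = sc * ln rho + \sum_(i < N) c i * ln (k * lam i + rho^-1).
Proof.
move=> k0 r0; rewrite mulr_suml -big_split/=; apply: eq_bigr => i _.
have h : 0 < k * lam i + rho^-1 by rewrite addr_gt0// ?mulr_gt0// invr_gt0.
by rewrite -mulrDr -lnM ?posrE//; congr (_ * ln _); field; rewrite gt_eqF.
Qed.

Lemma log_sum_ge0 s : 0 < s -> 0 <= log_sum lam s.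
Proof.
move=> s0; rewrite -lee_fin -integral_laplace_prod//.
apply: integral_ge0 => x; rewrite /= in_itv/= => /andP[x0 _].
by rewrite lee_fin ltW// laplace_prod_gt0.
Qed.

Variables (v : R -> R) (vinf om : R).
Hypothesis v_cvg : v rho @[rho --> +oo] --> vinf.
Hypothesis vln : v rho * (sc * ln rho) @[rho --> +oo] --> om.
Hypothesis vsc : vinf * sc = 0.

(** A limit common to two regimes: [v = 1], [om = 0] when [sc = 0], and [v = (ln rho)^-1],
    [vinf = 0], [om = sc] when N = 1. *)
Let l := om + vinf * \sum_(i < N) c i * ln (lam i).

(** Rescaling by [k] adds [vinf * sc * ln k], which [vsc] kills; hence the cut-off constant leaves
    no trace in the limit. *)
Let lE k : 0 < k -> l = om + vinf * \sum_(i < N) c i * ln (k * lam i).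
Proof.
move=> k0; rewrite /l; congr (_ + _).
have -> : \sum_(i < N) c i * ln (k * lam i) = sc * ln k + \sum_(i < N) c i * ln (lam i).
  rewrite mulr_suml -big_split/=; apply: eq_bigr => i _.
  by rewrite lnM ?posrE// mulrDr.
by rewrite mulrDr mulrA vsc mul0r add0r.
Qed.

Lemma scaled_log_sum_cvg k : 0 < k ->
  v rho * log_sum lam (k * rho) @[rho --> +oo] --> l.
Proof.
move=> k0; rewrite (lE k k0).
have : v rho * (sc * ln rho) + v rho * \sum_(i < N) c i * ln (k * lam i + rho^-1) @[rho --> +oo]
    --> om + vinf * \sum_(i < N) c i * ln (k * lam i).
  apply: cvgD => //; apply: cvgM => //; apply: cvg_sum_seq => i.
  apply: cvgM; first exact: cvg_cst.
  have kl : 0 < k * lam i by rewrite mulr_gt0.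
  apply: (@cvg_comp _ _ _ (fun rho : R => k * lam i + rho^-1) (@ln R)); last exact: continuous_ln.
  have : k * lam i + rho^-1 @[rho --> +oo] --> k * lam i + 0.
    by apply: cvgD; [exact: cvg_cst|exact: cvgV_pinfty].
  by rewrite addr0.
apply: cvg_trans; apply: near_eq_cvg.
have := nbhs_pinfty_gt (num_real (0 : R)); apply: filterS => rho r0.
by rewrite log_sumE// mulrDr.
Qed.

Lemma scaled_laplace_prod_cvg k : 0 < k ->
  v rho * (rho * laplace_prod lam (k * rho)) @[rho --> +oo] --> (0 : R).
Proof.
move=> k0.
have -> : (0 : R) = vinf * (k^-1 * sc) by rewrite mulrCA vsc mulr0.
have h : k * rho * laplace_prod lam (k * rho) @[rho --> +oo] --> sc.
  apply: (@cvg_comp _ _ _ (fun rho : R => k * rho) (fun s => s * laplace_prod lam s)).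
    exact: cvg_scale_pinfty.
  exact: mul_laplace_prod_cvg.
have : v rho * (k^-1 * (k * rho * laplace_prod lam (k * rho))) @[rho --> +oo]
    --> vinf * (k^-1 * sc).
  by apply: cvgM => //; apply: cvgM => //; exact: cvg_cst.
apply: cvg_trans; apply: near_eq_cvg; near=> rho.
by rewrite -!mulrA mulKf// gt_eqF.
Unshelve. all: by end_near. Qed.

(** The claimed asymptote is the same sum of logarithms with [k = Z^-1], as [- ln (Z / (lam i *
    rho)) = ln rho + ln (Z^-1 * lam i)]. *)
Lemma scaled_asymptote_cvg (C Z : R) : 0 < Z ->
  v rho * (C - \sum_(i < N) c i * Z * ln (Z / (lam i * rho))) @[rho --> +oo]
  --> C * vinf + Z * l.
Proof.
move=> Z0; have V0 : 0 < Z^-1 by rewrite invr_gt0.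
rewrite (lE _ V0).
have : C * v rho + Z * (v rho * (sc * ln rho) + v rho * \sum_(i < N) c i * ln (Z^-1 * lam i)) @[rho --> +oo]
    --> C * vinf + Z * (om + vinf * \sum_(i < N) c i * ln (Z^-1 * lam i)).
  apply: cvgD; first by apply: cvgM => //; exact: cvg_cst.
  apply: cvgM; first exact: cvg_cst.
  by apply: cvgD => //; apply: cvgM => //; exact: cvg_cst.
apply: cvg_trans; apply: near_eq_cvg.
have := nbhs_pinfty_gt (num_real (0 : R)); apply: filterS => rho r0.
rewrite -mulrDr [C * _]mulrC mulrCA -mulrDr; congr (_ * (_ + _)).
rewrite mulr_suml -big_split/= mulr_sumr -sumrN; apply: eq_bigr => i _.
have -> : Z / (lam i * rho) = (rho * (Z^-1 * lam i))^-1.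
  by field; rewrite !gt_eqF.
rewrite lnV ?posrE ?mulr_gt0// [in RHS]lnM ?posrE ?mulr_gt0//; ring.
Qed.

End asymptotics.

(** * The end-to-end SNR as a function of the two hops *)

Section relay_snr.
Context {R : realType}.
Implicit Types x y g kap : R.

Lemma relay_snr_lt x y g : 0 <= x -> 0 <= y ->
  (x * y / (y + x + 1) < g) = (x * y < g * (x + y + 1)).
Proof.
by move=> x0 y0; rewrite ltr_pdivrMr ?[y + x]addrC// ltr_wpDl// addr_ge0.
Qed.

Lemma relay_snr_lt_of_min x y g : 0 < g -> 0 <= x -> 0 <= y -> x < g \/ y < g ->
  x * y < g * (x + y + 1).
Proof. by move=> g0 x0 y0 [xg|yg]; nra. Qed.

(** The hypothesis reads [(x - g) * (y - g) < g * (g + 1)]. If one of the two exceeds g by at least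
    kap g, the other exceeds it by less than (g + 1) / kap. *)
Lemma relay_snr_lt_split x y g kap : 0 < g -> 0 < kap -> 0 <= x -> 0 <= y ->
  x * y < g * (x + y + 1) ->
  [\/ x < (1 + kap) * g, y < (1 + kap) * g |
      x < g + (g + 1) / kap /\ y < g + (g + 1) / kap].
Proof.
move=> g0 kap0 x0 y0 xy; set u := (g + 1) / kap.
have uk : u * kap = g + 1 by rewrite divfK// gt_eqF.
have u0 : 0 < u by rewrite divr_gt0// addr_gt0.
have [xg|xg] := ltP x ((1 + kap) * g); first exact: Or31.
have [yg|yg] := ltP y ((1 + kap) * g); first exact: Or32.
have far a b : (1 + kap) * g <= a -> g + u <= b -> g * (g + 1) <= (a - g) * (b - g).
  move=> ag bg; have -> : g * (g + 1) = (kap * g) * u by rewrite -uk; ring.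
  by apply: ler_pM; [rewrite mulr_ge0// ltW|exact: ltW|lra|lra].
have [xu|xu] := ltP x (g + u); last by have := far y x yg xu; lra.
have [yu|yu] := ltP y (g + u); last by have := far x y xg yu; lra.
exact: Or33.
Qed.

End relay_snr.

(** * Real-valued probabilities *)

Section real_probabilities.
Context {R : realType} {d : measure_display} {T : measurableType d}.
Variables (P : probability T R).

Lemma measurable_set_ltr (U V : T -> R) :
  measurable_fun setT U -> measurable_fun setT V -> measurable [set w | U w < V w].
Proof.
move=> mU mV.
have mVU : measurable_fun setT (fun w => V w - U w) by exact: measurable_funB.
have := mVU measurableT `]0, +oo[%classic (measurable_itv _).
rewrite setTI; congr measurable.
by apply/seteqP; split => w /=; rewrite in_itv/= andbT subr_gt0.
Qed.

Lemma fine_probabilityK A : measurable A -> (fine (P A))%:E = P A.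
Proof. by move=> mA; rewrite fineK// fin_num_measure. Qed.

Lemma le_fine_probability A B : measurable A -> measurable B -> A `<=` B ->
  fine (P A) <= fine (P B).
Proof.
by move=> mA mB AB; rewrite -lee_fin !fine_probabilityK// le_measure ?inE.
Qed.

Lemma fine_probabilityU A B : measurable A -> measurable B ->
  fine (P (A `|` B)) + fine (P (A `&` B)) = fine (P A) + fine (P B).
Proof.
move=> mA mB; have mI : measurable (A `&` B) by exact: measurableI.
have mU : measurable (A `|` B) by exact: measurableU.
apply/EFin_inj; rewrite !EFinD !fine_probabilityK// measureUfinl//.
  by rewrite subeK// fin_num_measure.
by rewrite -ge0_fin_numE// fin_num_measure.
Qed.

End real_probabilities.

(** * Events for the channel gains *)

Section fading_probabilities.
Context {R : realType} {d : measure_display} {T : measurableType d}.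
Variables (P : probability T R) (N : nat) (lam : 'I_N -> R).
Variable (W : 'I_N.+1 -> bool -> T -> R).
Hypothesis mW : forall k b, measurable_fun setT (W k b).
Hypothesis HW : iid_CSCG P W.
Hypothesis N_gt0 : (0 < N)%N.
Hypothesis lam_pos : forall i, 0 < lam i.
Hypothesis lam_distinct : forall i j : 'I_N, i != j -> lam i != lam j.

Local Notation emb := (widen_ord (leqnSn N)).
Local Notation g2 i := (sqmod W (emb i)).
Local Notation q2 := (sqmod W ord_max).

Definition gain_sum (w : T) : R := \sum_(i < N) lam i * g2 i w.

Let emb_inj : injective emb.
Proof. by move=> i j [] ij; exact: val_inj. Qed.

Let emb_max i : emb i != ord_max.
Proof. by rewrite -val_eqE/= ltn_eqF. Qed.

Lemma measurable_gain_sum : measurable_fun setT gain_sum.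
Proof.
by apply: measurable_sum => i; apply: measurable_funM => //; exact: measurable_sqmod.
Qed.

Lemma gain_sum_ge0 w : 0 <= gain_sum w.
Proof. by apply: sumr_ge0 => i _; rewrite mulr_ge0 ?sqmod_ge0// ltW. Qed.

Lemma gain_sum_ge i w : lam i * g2 i w <= gain_sum w.
Proof.
rewrite /gain_sum (bigD1 i)//= lerDl sumr_ge0// => j _.
by rewrite mulr_ge0 ?sqmod_ge0// ltW.
Qed.

Let mS := measurable_gain_sum.
Let msq k : measurable_fun setT (sqmod W k). Proof. exact: measurable_sqmod. Qed.

Let mSQ : measurable_fun setT (fun w => gain_sum w * q2 w).
Proof. exact: measurable_funM. Qed.

Lemma measurable_sqmod_lt k t : measurable [set w | sqmod W k w < t].
Proof. by apply: measurable_set_ltr. Qed.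

Lemma measurable_product_lt e : measurable [set w | gain_sum w * q2 w < e].
Proof. by apply: measurable_set_ltr. Qed.

Lemma fine_sqmod_bounds k t : 0 < t ->
  t * expR (- t) <= fine (P [set w | sqmod W k w < t]) <= t.
Proof.
move=> t0; rewrite -!lee_fin fine_probabilityK; last exact: measurable_sqmod_lt.
exact: sqmod_law_bounds.
Qed.

Let indepSQ : indep2 P gain_sum q2.
Proof.
apply: (@indep2_groups _ _ _ _ _ _ mW HW (predC1 ord_max) (pred1 ord_max)).
- by [].
- by apply: depends_on_comb => //; apply/allP => i _ /=; exact: emb_max.
- by apply: depends_on_sqmod; rewrite /= eqxx.
Qed.

Let laplace_gain_sum s : 0 <= s ->
  (\int[P]_w (expR (- (s * gain_sum w)))%:E = (laplace_prod lam s)%:E)%E.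
Proof.
move=> s0; apply: laplace_comb => //; first by rewrite /index_enum -enumT enum_uniq.
by move=> i; exact: ltW.
Qed.

Lemma fine_product_le e s : 0 < e -> 0 < s ->
  fine (P [set w | gain_sum w * q2 w < e]) <= e * log_sum lam s + laplace_prod lam s.
Proof.
move=> e0 s0; rewrite -lee_fin fine_probabilityK; last exact: measurable_product_lt.
apply: (@product_small_ball_le _ _ _ P (mfun_of _ mS) (mfun_of _ (msq ord_max))) => //.
- exact: gain_sum_ge0.
- by move=> t t0; exact: sqmod_law_bounds.
- exact: integral_laplace_prod.
Qed.

Lemma fine_product_ge e s : 0 < e -> 0 < s ->
  e * log_sum lam s <= fine (P [set w | gain_sum w * q2 w < e])
    + e * s * (e * log_sum lam s + laplace_prod lam s).
Proof.
move=> e0 s0; rewrite -lee_fin EFinD fine_probabilityK; last exact: measurable_product_lt.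
apply: (@product_small_ball_ge _ _ _ P (mfun_of _ mS) (mfun_of _ (msq ord_max))) => //.
- exact: gain_sum_ge0.
- by move=> t t0; exact: sqmod_law_bounds.
- exact: integral_laplace_prod.
Qed.

Lemma fine_sqmod_pair_le k k' t u : k != k' -> 0 < t -> 0 < u ->
  fine (P ([set w | sqmod W k w < t] `&` [set w | sqmod W k' w < u])) <= t * u.
Proof.
move=> kk t0 u0.
have : indep2 P (sqmod W k) (sqmod W k').
  apply: (@indep2_groups _ _ _ _ _ _ mW HW (pred1 k) (pred1 k')).
  - by move=> j /eqP ->.
  - by apply: depends_on_sqmod; rewrite /= eqxx.
  - by apply: depends_on_sqmod; rewrite /= eqxx.
move=> /(_ `]-oo, t[%classic `]-oo, u[%classic (measurable_itv _) (measurable_itv _)).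
have pre j r : sqmod W j @^-1` `]-oo, r[%classic = [set w | sqmod W j w < r].
  by apply/seteqP; split => w /=; rewrite in_itv.
rewrite !pre => ->.
rewrite fineM ?fin_num_measure//; try exact: measurable_sqmod_lt.
have /andP[_ h1] := fine_sqmod_bounds k t t0.
have /andP[_ h2] := fine_sqmod_bounds k' u u0.
by apply: ler_pM => //; apply: fine_ge0.
Qed.

(** [S] involves [g2 i], so the two events are dependent. Keeping only the branch [j] of [S], the
    second event forces [g2 j < u] or [q2 < e / (lam j * u)], and each of these is independent of
    [g2 i]. The level [u] is free. *)
Lemma fine_joint_le i j t e u : i != j -> 0 < t -> 0 < e -> 0 < u ->
  fine (P ([set w | g2 i w < t] `&` [set w | gain_sum w * q2 w < e])) <=
  t * (u + e / (lam j * u)).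
Proof.
move=> ij t0 e0 u0.
have eu : 0 < e / (lam j * u) by rewrite divr_gt0// mulr_gt0.
set A := [set w | g2 i w < t].
set B := [set w | g2 j w < u]; set D := [set w | q2 w < e / (lam j * u)].
have mA : measurable A by exact: measurable_sqmod_lt.
have mB : measurable B by exact: measurable_sqmod_lt.
have mD : measurable D by exact: measurable_sqmod_lt.
have mAB : measurable (A `&` B) by exact: measurableI.
have mAD : measurable (A `&` D) by exact: measurableI.
apply: (@le_trans _ _ (fine (P ((A `&` B) `|` (A `&` D))))).
  apply: le_fine_probability.
  - by apply: measurableI => //; exact: measurable_product_lt.
  - exact: measurableU.
  - move=> w [Aw /= Sw]; have [jw|jw] := ltP (g2 j w) u; [by left|right].
    split => //; rewrite /D/= ltr_pdivlMr ?mulr_gt0//.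
    apply: le_lt_trans Sw; rewrite mulrC; apply: ler_wpM2r; first exact: sqmod_ge0.
    apply: le_trans (gain_sum_ge j w).
    by rewrite ler_pM2l.
have := fine_probabilityU P (A `&` B) (A `&` D) mAB mAD.
have I0 : 0 <= fine (P (A `&` B `&` (A `&` D))) by apply: fine_ge0.
have h1 : fine (P (A `&` B)) <= t * u.
  by apply: fine_sqmod_pair_le => //; rewrite (inj_eq emb_inj).
have h2 : fine (P (A `&` D)) <= t * (e / (lam j * u)) by exact: fine_sqmod_pair_le.
by rewrite mulrDr; lra.
Qed.

End fading_probabilities.

(* Index k : 'I_N.+1 : components k < N are g_(k+1), component N is q. *)
Theorem theorem6 (R : realType) (d : measure_display) (T : measurableType d)
  (P : probability T R) (N : nat) (hN : (0 < N)%N)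
  (eta theta d1 d2 tau gth sigma1 : R) (lam : 'I_N -> R)
  (W : 'I_N.+1 -> bool -> T -> R)
  (Wmeas : forall k b, measurable_fun setT (W k b))
  (HW : iid_CSCG P W)
  (Heta : 0 < eta <= 1) (Htheta : 0 < theta < 1)
  (Hd1 : 0 < d1) (Hd2 : 0 < d2) (Htau : 0 < tau) (Hgth : 0 < gth)
  (Hsigma1 : 0 < sigma1)
  (Hlam_pos : forall i, 0 < lam i)
  (Hlam_sorted : forall i j : 'I_N, (i <= j)%N -> lam j <= lam i)
  (Hlam_distinct : forall i j : 'I_N, i != j -> lam i != lam j) :
  let i1 : 'I_N := Ordinal hN in
  let g2 (i : 'I_N) : T -> R := sqmod W (widen_ord (leqnSn N) i) in
  let q2 : T -> R := sqmod W ord_max in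
  let S (w : T) : R := \sum_(i < N) lam i * g2 i w in
  let gammaS (rho : R) (w : T) : R :=
    (eta * theta * (1 - theta) * rho ^+ 2 / (d1 `^ (2 * tau) * d2 `^ tau))
      * S w * (lam i1 * g2 i1 w) * (sigma1 * q2 w)
    / ((eta * theta * rho / (d1 `^ tau * d2 `^ tau)) * S w * (sigma1 * q2 w)
       + ((1 - theta) * rho / d1 `^ tau) * (lam i1 * g2 i1 w) + 1) in
  let PS (rho : R) : R := fine (P [set w | gammaS rho w < gth]) in
  let Z : R := d1 `^ tau * d2 `^ tau * gth / (eta * theta * sigma1) in
  let A (rho : R) : R :=
    rho^-1 * (gth * d1 `^ tau / ((1 - theta) * lam i1)
      - \sum_(i < N) lam i ^ (N%:Z - 2)
                     / (\prod_(j < N | j != i) (lam i - lam j))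
                     * Z * ln (Z / (lam i * rho))) in
  (PS rho / A rho @[rho --> +oo%R] --> (1:R)) /\
  ((2 <= N)%N -> exists c : R, 0 < c /\ (rho * PS rho @[rho --> +oo%R] --> c)).
Proof.
move=> i1 g2 q2 S gammaS PS Z A.
have [eta0 _] := andP Heta; have [theta0 theta1] := andP Htheta.
have lamN0 i : lam i != 0 by rewrite gt_eqF.
pose D1 := d1 `^ tau; pose D2 := d2 `^ tau.
have D1_gt0 : 0 < D1 by exact: powR_gt0.
have D2_gt0 : 0 < D2 by exact: powR_gt0.
(* The hop SNRs are x = [al * rho * g2 i1] and y = [be * rho * (S * q2)]; thus [C] and [Z] are the
   threshold [gth] divided by [al] and [be]. *)
pose al := (1 - theta) * lam i1 / D1.
pose be := eta * theta * sigma1 / (D1 * D2).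
have al0 : 0 < al by rewrite divr_gt0// mulr_gt0// subr_gt0.
have be0 : 0 < be by rewrite divr_gt0// !mulr_gt0.
pose C := gth * D1 / ((1 - theta) * lam i1).
have Cal : C = gth / al.
  by rewrite /C /al; field; rewrite lamN0 !gt_eqF// subr_gt0.
have Zbe : Z = gth / be by rewrite /Z /be -/D1 -/D2; field; rewrite !gt_eqF.
have C0 : 0 < C by rewrite Cal divr_gt0.
have Z0 : 0 < Z by rewrite Zbe divr_gt0.
have mSQ e : measurable [set w | S w * q2 w < e] by exact: measurable_product_lt.
have mX t : measurable [set w | g2 i1 w < t] by exact: measurable_sqmod_lt.
pose EX t := [set w | g2 i1 w < t].
pose EY e := [set w | S w * q2 w < e].
pose pX t := fine (P (EX t)).
pose pY e := fine (P (EY e)).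
pose pXY t e := fine (P (EX t `&` EY e)).
have X_ge0 w : 0 <= g2 i1 w by exact: sqmod_ge0.
have SQ_ge0 w : 0 <= S w * q2 w by rewrite mulr_ge0 ?sqmod_ge0// gain_sum_ge0.
have gammaSE rho w : 0 < rho -> (gammaS rho w < gth) =
    ((al * rho * g2 i1 w) * (be * rho * (S w * q2 w)) <
     gth * (al * rho * g2 i1 w + be * rho * (S w * q2 w) + 1)).
  move=> rho0; rewrite -relay_snr_lt; try by rewrite mulr_ge0// ltW// mulr_gt0.
  congr (_ / _ < _); last first.
    by rewrite /al /be -/D1 -/D2; field; rewrite !gt_eqF.
  have -> : d1 `^ (2 * tau) = D1 ^+ 2.
    by rewrite mulrC powRrM powR_mulrn// ltW.
  by rewrite /al /be -/D2; field; rewrite !gt_eqF.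
have mg2 : measurable_fun setT (g2 i1) by exact: measurable_sqmod.
have mSq : measurable_fun setT (fun w => S w * q2 w).
  by apply: measurable_funM; [exact: measurable_gain_sum|exact: measurable_sqmod].
have mE rho : 0 < rho -> measurable [set w | gammaS rho w < gth].
  move=> rho0; under eq_set => w do rewrite gammaSE//.
  apply: measurable_set_ltr.
    by apply: measurable_funM; apply: measurable_funM.
  apply: measurable_funM => //; apply: measurable_funD => //.
  by apply: measurable_funD; apply: measurable_funM.
have x_ge0 rho w : 0 < rho -> 0 <= al * rho * g2 i1 w.
  by move=> rho0; apply: mulr_ge0 => //; apply/ltW/mulr_gt0.
have y_ge0 rho w : 0 < rho -> 0 <= be * rho * (S w * q2 w).
  by move=> rho0; apply: mulr_ge0 => //; apply/ltW/mulr_gt0.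
have EXE rho h w : 0 < rho -> (al * rho * g2 i1 w < h) = (g2 i1 w < h / al / rho).
  move=> rho0; rewrite -mulrA ltr_pdivlMr// ltr_pdivlMr//; congr (_ < _); ring.
have EYE rho h w : 0 < rho -> (be * rho * (S w * q2 w) < h) = (S w * q2 w < h / be / rho).
  move=> rho0; rewrite -mulrA ltr_pdivlMr// ltr_pdivlMr//; congr (_ < _); ring.
have pS_le kap : 0 < kap -> exists m1 m2, [/\ 0 < m1, 0 < m2 & forall rho, 0 < rho ->
    PS rho <= pX ((1 + kap) * C / rho) + pY ((1 + kap) * Z / rho)
              + pXY (m1 / rho) (m2 / rho)].
  move=> kap0; set M := gth + (gth + 1) / kap.
  have M0 : 0 < M by rewrite addr_gt0// divr_gt0// addr_gt0.
  exists (M / al), (M / be); split; [exact: divr_gt0|exact: divr_gt0|move=> rho rho0].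
  rewrite /pX /pY /pXY; set a := EX _; set b := EY _; set c := _ `&` _.
  have mc : measurable c by apply: measurableI; [exact: mX|exact: mSQ].
  have mab : measurable (a `|` b) by apply: measurableU; [exact: mX|exact: mSQ].
  apply: (@le_trans _ _ (fine (P (a `|` b `|` c)))).
    apply: le_fine_probability; [exact: mE|exact: measurableU|].
    move=> w /=; rewrite gammaSE// => xy.
    have [] := relay_snr_lt_split _ _ _ _ Hgth kap0 (x_ge0 _ w rho0) (y_ge0 _ w rho0) xy;
      rewrite -/M.
    - by rewrite EXE// -[(1 + kap) * gth / al]mulrA -Cal => ?; left; left.
    - by rewrite EYE// -[(1 + kap) * gth / be]mulrA -Zbe => ?; left; right.
    - by rewrite EXE// EYE// => ?; right.
  have := fine_probabilityU P (a `|` b) c mab mc.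
  have := fine_probabilityU P a b (mX _) (mSQ _).
  have : 0 <= fine (P (a `&` b)) by exact: fine_ge0.
  have : 0 <= fine (P ((a `|` b) `&` c)) by exact: fine_ge0.
  by rewrite /PS; lra.
have pS_ge rho : 0 < rho -> pX (C / rho) + pY (Z / rho) <= PS rho + pXY (C / rho) (Z / rho).
  move=> rho0; rewrite /pX /pY /pXY -fine_probabilityU; [|exact: mX|exact: mSQ].
  rewrite lerD2r; apply: le_fine_probability; [|exact: mE|].
    by apply: measurableU; [exact: mX|exact: mSQ].
  move=> w ab /=; rewrite gammaSE//; apply: relay_snr_lt_of_min => //.
  - exact: x_ge0.
  - exact: y_ge0.
  - by rewrite EXE// EYE// -Cal -Zbe; exact: ab.
have pX_bounds := @fine_sqmod_bounds _ _ _ P _ _ Wmeas HW (widen_ord (leqnSn N) i1).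
have pY_le := @fine_product_le _ _ _ P _ _ _ Wmeas HW hN Hlam_pos Hlam_distinct.
have pY_ge := @fine_product_ge _ _ _ P _ _ _ Wmeas HW hN Hlam_pos Hlam_distinct.
pose sc := \sum_(i < N) pf_coef lam i.
pose B rho := C - \sum_(i < N) pf_coef lam i * Z * ln (Z / (lam i * rho)).
(* Both regimes at once. The ratio is obtained under [c != 0], which each regime establishes in its
   own way. *)
have main (v : R -> R) (vinf om : R) : (\forall rho \near +oo, 0 < v rho) ->
    v rho @[rho --> +oo] --> vinf -> v rho * (sc * ln rho) @[rho --> +oo] --> om ->
    vinf * sc = 0 ->
    (forall m1 m2, 0 < m1 -> 0 < m2 ->
      v rho * (rho * pXY (m1 / rho) (m2 / rho)) @[rho --> +oo] --> (0 : R)) ->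
    let c := C * vinf + Z * (om + vinf * \sum_(i < N) pf_coef lam i * ln (lam i)) in
    v rho * (rho * PS rho) @[rho --> +oo] --> c /\
    (c != 0 -> PS rho / A rho @[rho --> +oo] --> (1 : R)).
  move=> v_gt0 v_cvg vln vsc vXY c.
  have lim : v rho * (rho * PS rho) @[rho --> +oo] --> c.
    apply: (@outage_limit _ PS pX pY (log_sum lam) (laplace_prod lam) v pXY) => //.
    - by move=> k k0; exact: scaled_log_sum_cvg.
    - by move=> k k0; exact: (@scaled_laplace_prod_cvg _ _ _ hN Hlam_pos Hlam_distinct v vinf).
  split => // c_neq0.
  (* [B rho] is [rho * A rho]; numerator and denominator of the ratio, both multiplied by
     [v rho * rho], share the limit [c]. *)
  have limB : v rho * B rho @[rho --> +oo] --> c by exact: scaled_asymptote_cvg.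
  have : (v rho * (rho * PS rho)) / (v rho * B rho) @[rho --> +oo] --> c / c.
    by apply: cvgM => //; exact: cvgV.
  rewrite divff//; apply: cvg_trans; apply: near_eq_cvg.
  have := nbhs_pinfty_gt (num_real (0 : R)); move: v_gt0; apply: filterS2 => rho vr rho0.
  rewrite -mulf_div divff ?gt_eqF// mul1r /A -/(B rho) invfM invrK.
  by rewrite [rho * _]mulrC -!mulrA.
have [N1|N1] := ltnP 1 N.
- have sc0 : sc = 0 by exact: sum_pf_coef_eq0.
  have [] := main (fun=> 1) 1 0.
  + exact: nearW.
  + exact: cvg_cst.
  + by under eq_fun do rewrite sc0 mul0r mulr0; exact: cvg_cst.
  + by rewrite sc0 mulr0.
  + move=> m1 m2 m10 m20; pose i2 := Ordinal N1.
    (* The level [u = rho^(-1/2)] balances the two terms of [fine_joint_le]; rho times its bound is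
       then exactly [K * u]. *)
    pose K := m1 * (1 + m2 / lam i2).
    have sq0 : K * Num.sqrt rho^-1 @[rho --> +oo] --> (0 : R).
      have : K * Num.sqrt rho^-1 @[rho --> +oo] --> K * Num.sqrt 0.
        apply: cvgM; first exact: cvg_cst.
        apply: (@cvg_comp _ _ _ (fun x : R => x^-1) Num.sqrt); last exact: sqrt_continuous.
        exact: cvgV_pinfty.
      by rewrite sqrtr0 mulr0.
    apply: squeeze_cvgr (cvg_cst _) sq0.
    have := nbhs_pinfty_gt (num_real (0 : R)); apply: filterS => rho rho0.
    rewrite mul1r; apply/andP; split; first by rewrite mulr_ge0 ?(ltW rho0)// fine_ge0.
    set u := Num.sqrt rho^-1.
    have u0 : 0 < u by rewrite sqrtr_gt0 invr_gt0.
    have u2 : rho = (u ^+ 2)^-1 by rewrite sqr_sqrtr ?invrK// invr_ge0 ltW.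
    have := @fine_joint_le _ _ _ P _ _ _ Wmeas HW Hlam_pos i1 i2 (m1 / rho) (m2 / rho) u
      isT (divr_gt0 m10 rho0) (divr_gt0 m20 rho0) u0.
    rewrite -(ler_pM2l rho0) => /le_trans; apply; rewrite le_eqVlt; apply/orP; left.
    apply/eqP; rewrite u2 /K; field.
    by rewrite !gt_eqF.
  set l := 0 + 1 * _; rewrite mulr1 => lim1 lim2.
  (* [l] is a limit of the nonnegative integrals [log_sum], so [C + Z * l] is positive: it is both
     the nonzero divisor and the diversity constant. *)
  have l0 : 0 <= l.
    have liml : 1 * log_sum lam (1 * rho) @[rho --> +oo] --> l.
      apply: (@scaled_log_sum_cvg _ _ _ Hlam_pos (fun=> 1) 1 0) => //.
      - exact: cvg_cst.
      - by under eq_fun do rewrite -/sc sc0 mul0r mulr0; exact: cvg_cst.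
      - by rewrite -/sc sc0 mulr0.
    rewrite -(cvg_lim (@norm_hausdorff _ R) liml); apply: limr_ge.
      by apply/cvg_ex; exists l.
    have := nbhs_pinfty_gt (num_real (0 : R)); apply: filterS => rho rho0.
    by rewrite !mul1r log_sum_ge0.
  have c0 : 0 < C + Z * l by rewrite ltr_wpDr// mulr_ge0// ltW.
  split; first by apply: lim2; rewrite gt_eqF.
  move=> _; exists (C + Z * l); split => //.
  by move: lim1; under eq_fun do rewrite mul1r.
- split; last by [].
  have i1_unique (j : 'I_N) : j = i1.
    by apply/val_inj/eqP; rewrite /= -leqn0 -ltnS; exact: leq_trans (ltn_ord j) N1.
  (* With a single branch the product is empty and the exponent is -1, so [sc] is the inverse of the
     eigenvalue. *)
  have sc_gt0 : 0 < sc.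
    rewrite /sc (bigD1 i1)//= [X in _ + X]big1 ?addr0; last first.
      by move=> j; rewrite (i1_unique j) eqxx.
    rewrite /pf_coef big1 ?divr1 ?exprz_gt0//.
    by move=> j; rewrite (i1_unique j) eqxx.
  have ln_gt0 : \forall rho \near +oo, 0 < ln rho :> R.
    by have := @cvg_ln_pinfty R => /cvgryPgt; exact.
  (* Under this weight the first hop disappears and only the logarithm survives: the limit is
     [Z * sc]. *)
  have [] := main (fun rho => (ln rho)^-1) 0 sc.
  + by apply: filterS ln_gt0 => rho; rewrite invr_gt0.
  + by apply: cvgV_pinfty; exact: cvg_ln_pinfty.
  + apply: (@cvg_trans _ ((fun=> sc) @ (+oo : set_system R))); last exact: cvg_cst.
    apply: near_eq_cvg; apply: filterS ln_gt0 => rho l0.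
    by rewrite mulrCA mulVf ?mulr1// gt_eqF.
  + by rewrite mul0r.
  + move=> m1 m2 m10 m20.
    have sq0 : m1 * (ln rho)^-1 @[rho --> +oo] --> (0 : R).
      have : m1 * (ln rho)^-1 @[rho --> +oo] --> m1 * 0.
        apply: cvgM; first exact: cvg_cst.
        by apply: cvgV_pinfty; exact: cvg_ln_pinfty.
      by rewrite mulr0.
    apply: squeeze_cvgr (cvg_cst _) sq0.
    have := nbhs_pinfty_gt (num_real (0 : R)); move: ln_gt0; apply: filterS2 => rho l0 rho0.
    have iV : 0 < (ln rho)^-1 by rewrite invr_gt0.
    apply/andP; split.
      by rewrite mulr_ge0 ?(ltW iV)// mulr_ge0 ?(ltW rho0)// fine_ge0.
    rewrite [leRHS]mulrC ler_pM2l// mulrC -ler_pdivlMr//.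
    (* The joint event is bounded by the first hop alone, of probability at most [m1 / rho]; the
       weight sends this to 0. *)
    have /andP[_] := pX_bounds _ (divr_gt0 m10 rho0); apply: le_trans.
    apply: le_fine_probability; [|exact: mX|exact: subIsetl].
    by apply: measurableI; [exact: mX|exact: mSQ].
  move=> _; apply; rewrite mulr0 mul0r addr0 add0r.
  by rewrite gt_eqF// mulr_gt0.
Qed.
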